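(* Let $p_1<p_2$ be finite real numbers, let $I$ be an open interval containing $[p_1,p_2]$, and let $\mu\in(0,1]$. Suppose that $U:(p_1,p_2]\to\mathbb{C}$ satisfies Assumption (A$_{p_1,\mu}$) with regular factor $\tilde u$ (see context), that $\psi:I\to\mathbb{R}$ belongs to $\mathcal{C}^2([p_1,p_2])$, and that $\psi'$ does not vanish and is monotone on $[p_1,p_2]$. In addition assume that $\tilde u\in\mathcal{C}^1([p_1,p_2])$ with $\tilde u(p_1)\neq0$. Then the decay rate $\omega^{-\mu}$ in the estimate $$\left|\int_{p_1}^{p_2}U(p)\,e^{i\omega\psi(p)}\,dp\right|\leqslant C_c(U,\psi)\,\omega^{-\mu}\qquad(\omega>0)$$ (where $C_c(U,\psi)$ does not depend on $\omega$) is optimal, that is, $$\limsup_{\omega\to+\infty}\ \omega^{\mu}\left|\int_{p_1}^{p_2}U(p)\,e^{i\omega\psi(p)}\,dp\right|>0 .$$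
   Context: Assumption (A$_{p_1,\mu}$) (with $\mu\in(0,1]$): for $U:(p_1,p_2]\to\mathbb{C}$ there exists $\tilde u:[p_1,p_2]\to\mathbb{C}$ such that $U(p)=(p-p_1)^{\mu-1}\,\tilde u(p)$ for all $p\in(p_1,p_2]$, where $\tilde u$ is continuous on $[p_1,p_2]$, differentiable on $(p_1,p_2)$ with $\tilde u'\in L^1(p_1,p_2)$, and $\tilde u(p_1)\neq0$ if $\mu\neq1$. The function $\tilde u$ is called the regular factor of $U$. *)

(* Defs.v *)
From HB Require Import structures.
From mathcomp Require Import all_boot all_order all_algebra.
From mathcomp Require Import complex.
From mathcomp Require Import all_classical all_reals all_analysis.
Set Implicit Arguments.
Unset Strict Implicit.
Unset Printing Implicit Defensive.
Import Order.TTheory GRing.Theory Num.Theory.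
Import numFieldNormedType.Exports.
Local Open Scope classical_set_scope.
Local Open Scope ring_scope.

(* Complex numbers are [Rcomplex R]: the field R[i] with its structure of
   R-vector space and the R-valued modulus as norm.  The instances below add
   the induced topology, which makes it a normed module over R, so that
   [continuous], [derivable], [derive1] and [`| _ |] apply to R -> Rcomplex R. *)
Section Rcomplex_normedModType.
Variable R : realType.

Fact Rcomplex_normrZ (l : R) (z : Rcomplex R) : `|l *: z| = `|l| * `|z|.
Proof.
case: z => a b; rewrite /Num.norm/= !exprMn -mulrDr sqrtrM ?sqr_ge0//.
by rewrite sqrtr_sqr.
Qed.

HB.instance Definition _ :=
  PseudoMetric.copy (Rcomplex R) (pseudoMetric_normed (Rcomplex R)).
HB.instance Definition _ := isPointed.Build (Rcomplex R) 0.
HB.instance Definition _ :=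
  NormedZmod_PseudoMetric_eq.Build R (Rcomplex R) erefl.
HB.instance Definition _ :=
  PseudoMetricNormedZmod_Lmodule_isNormedModule.Build R (Rcomplex R)
    Rcomplex_normrZ.

End Rcomplex_normedModType.

Section complex_valued.
Variable R : realType.
Implicit Types (D : set R) (f : R -> Rcomplex R).

Definition Rcomplex_of (a b : R) : Rcomplex R := Complex a b.

Definition expi (t : R) : Rcomplex R := Rcomplex_of (cos t) (sin t).

Definition Cintegrable D f :=
  lebesgue_measure.-integrable D (fun x => (complex.Re (f x))%:E) /\
  lebesgue_measure.-integrable D (fun x => (complex.Im (f x))%:E).

Definition Cintegral D f : Rcomplex R :=
  Rcomplex_of (\int[lebesgue_measure]_(x in D) complex.Re (f x))
              (\int[lebesgue_measure]_(x in D) complex.Im (f x)).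

End complex_valued.

(* Derivative relative to D: the difference quotient at x only uses points of
   D, so it is one-sided at an end point when D is a closed interval. *)
Section derivative_within.
Variables (R : realType) (V : normedModType R).
Implicit Types (D : set R) (f : R -> V).

Definition diff_quotient f (x y : R) : V := (y - x)^-1 *: (f y - f x).

Definition derivable_within D f (x : R) :=
  cvg (diff_quotient f x y @[y --> within D x^']).

Definition derive_within D f (x : R) : V :=
  lim (diff_quotient f x y @[y --> within D x^']).

Fixpoint class_C (k : nat) D f : Prop :=
  if k is k'.+1 then
    (forall x, D x -> derivable_within D f x) /\
    class_C k' D (derive_within D f)
  else {within D, continuous f}.

End derivative_within.

Section oscillatory.
Variable R : realType.

Definition regular_factor (p1 p2 mu : R) (U u : R -> Rcomplex R) :=
  [/\ forall p, p1 < p <= p2 -> U p = (p - p1) `^ (mu - 1) *: u p,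
      {within `[p1, p2], continuous u},
      (forall p, p1 < p < p2 -> derivable u p 1),
      Cintegrable `]p1, p2[ (derive1 u)
    & mu != 1 -> u p1 != 0].

Definition oscillatory_integral (p1 p2 : R) (U : R -> Rcomplex R)
    (psi : R -> R) (omega : R) : Rcomplex R :=
  Cintegral `]p1, p2] (fun p => U p * expi (omega * psi p)).

End oscillatory.

(* Main.v *)
Require Import Defs.
From HB Require Import structures.
From mathcomp Require Import all_boot all_order all_algebra.
From mathcomp Require Import complex.
From mathcomp Require Import all_classical all_reals all_analysis.
From mathcomp Require Import measurable_realfun ring lra.
Set Implicit Arguments.
Unset Strict Implicit.
Unset Printing Implicit Defensive.
Import Order.TTheory GRing.Theory Num.Theory.
Import numFieldNormedType.Exports.
Local Open Scope classical_set_scope.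
Local Open Scope ring_scope.


(** The decay of an oscillatory integral can be bounded from below without an
    asymptotic expansion, by averaging in the frequency.

    Put th = psi - psi p1.  Multiplying the integral by the conjugate of u p1 and by
    e^(- i omega psi p1), and taking the imaginary part, gives a real function
      Y omega = \int (p - p1)^(mu - 1) (A p sin (omega th p) + B p cos (omega th p)) dp
    with |Y| at most |u p1| times the modulus of the integral, A p1 = |u p1|^2 > 0 and
    B p1 = 0 (rotated_oscillatory_integral).  Since psi' is continuous, monotone and
    nowhere zero, th has constant sign and |th p| lies between two positive multiples
    of p - p1 (phase_linear_bounds); the sign can be absorbed into B, so take th > 0.

    Average Y against the weight omega e^(- l omega) on [0, +oo[.  By Fubini the sine
    and the cosine are replaced by
      2 l th / (l^2 + th^2)^2   and   (l^2 - th^2) / (l^2 + th^2)^2,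
    the imaginary and real parts of (l - i th)^-2 (laplace_oscillatory).  The first is
    positive, and both are concentrated at distance l from p1, where A is bounded below
    and B is small.  Hence the average is at least k l^(mu - 2) - O(1) as l tends to 0,
    for some k > 0 (averaged_integral_ge).  On the other hand, if omega^mu |Y omega|
    were eventually at most e, the average would be at most 2 e l^(mu - 2) + O(1)
    (laplace_decay_le).  For e = k / 8 the two are incompatible for small l, which bounds
    the limit superior from below (oscillatory_decay_optimal).

    The weight vanishes at omega = 0.  This is what makes the transformed kernels decay
    like th^-2 instead of th^-1, so that one argument covers mu = 1, where the end point
    p2 contributes at the same order as p1. *)

(** * Integrals over half-open intervals *)

Section half_open_integrals.
Variable R : realType.
Local Notation mu := (@lebesgue_measure R).

Lemma integrable_mul_bounded (D : set R) (u v : R -> R) (K : R) :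
  measurable D -> mu.-integrable D (EFin \o u) -> measurable_fun D v ->
  (forall x, D x -> `|v x| <= K) -> mu.-integrable D (fun p => (u p * v p)%:E).
Proof.
move=> mD ju mv vK.
have jK : mu.-integrable D (fun p => (K%:E * (u p)%:E)%E) by apply: integrableZl ju.
apply: le_integrable jK => //.
  have /integrableP[/measurable_EFinP mu' _] := ju.
  by apply/measurable_EFinP/measurable_funM.
move=> y Dy; rewrite -EFinM /= lee_fin !normrM mulrC ler_wpM2r//.
by apply: le_trans (vK _ Dy) _; exact: ler_norm.
Qed.

Lemma le_Rintegral_EFin (D : set R) (f : R -> R) (v : R) :
  measurable D -> mu.-integrable D (EFin \o f) ->
  (\int[mu]_(x in D) (f x)%:E <= v%:E)%E -> \int[mu]_(x in D) f x <= v.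
Proof.
move=> mD jf; rewrite -lee_fin /Rintegral fineK//.
exact: (integrable_fin_num _ jf).
Qed.

Lemma le_Rintegral_obnd_cst (f : R -> R) (a b x y m : R) :
  mu.-integrable `]a, b] (EFin \o f) -> (forall p, a < p <= b -> 0 <= f p) ->
  a <= x -> x <= y -> y <= b -> (forall p, x < p <= y -> m <= f p) ->
  m * (y - x) <= \int[mu]_(p in `]a, b]) f p.
Proof.
move=> jf f0 ax xy yb mf.
have sub : [set` `]x, y]] `<=` [set` `]a, b]].
  move=> p /=; rewrite !in_itv /= => /andP[xp py].
  by rewrite (le_lt_trans ax xp) (le_trans py yb).
have jf' : mu.-integrable `]x, y] (EFin \o f) by exact: integrableS jf.
apply: (@le_trans _ _ (\int[mu]_(p in `]x, y]) f p)).
  have -> : m * (y - x) = \int[mu]_(p in `]x, y]) m.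
    rewrite Rintegral_cst//= lebesgue_measure_itv /= lte_fin.
    by case: ltgtP xy => //= xy' _; rewrite ?xy' ?subrr.
  apply: le_Rintegral => //.
    apply: measurable_bounded_integrable => //.
      by rewrite /= lebesgue_measure_itv /=; case: ifP => _; rewrite ltry.
    by exists `|m|; split; [exact: num_real|move=> z mz w _ /=; exact: ltW].
apply: fine_le; [exact: (integrable_fin_num _ jf')|exact: (integrable_fin_num _ jf)|].
apply: ge0_subset_integral => //.
by have /integrableP[] := jf.
Qed.

Lemma measurable_fun_obnd_continuous (f : R -> R) (a b : R) :
  (forall x, a < x -> {for x, continuous f}) -> measurable_fun `]a, b] f.
Proof.
move=> cf; apply: subspace_continuous_measurable_fun => //.
apply: continuous_in_subspaceT => x /set_mem /=.
by rewrite in_itv /= => /andP[/cf].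
Qed.

Lemma within_continuous_measurable_oc (f : R -> R) (a b : R) :
  {within `[a, b], continuous f} -> measurable_fun `]a, b] f.
Proof.
move=> cf; apply: (@measurable_funS _ _ _ _ `[a, b]) => //.
  by move=> x /=; rewrite !in_itv /= => /andP[/ltW -> ->].
exact: subspace_continuous_measurable_fun.
Qed.

(** The integrals over [a + 1/n, b] are at most G b - G (a + 1/n) <= G b, and they
    increase to the integral over ]a, b].  This allows g to be singular at a. *)
Lemma ge0_integral_obnd_le (g G : R -> R) (a b : R) : a < b ->
  (forall x, a < x <= b -> is_derive x 1 G (g x)) ->
  (forall x, a < x <= b -> 0 <= g x) ->
  (forall x, a < x <= b -> 0 <= G x) ->
  (forall x, a < x <= b -> {for x, continuous g}) ->
  (\int[mu]_(x in `]a, b]) (g x)%:E <= (G b)%:E)%E.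
Proof.
move=> ab dG g0 G0 cg.
pose F n := [set` `[a + n.+1%:R^-1, b]] : set R.
have FE : [set` `]a, b]] = \bigcup_n F n.
  apply/seteqP; split => x /=.
    rewrite in_itv /= => /andP[ax xb].
    have [n nx] := ltr_add_invr ax.
    by exists n => //; rewrite /F /= in_itv /= xb andbT ltW.
  move=> [n _]; rewrite /F /= !in_itv /= => /andP[ax ->]; rewrite andbT.
  by apply: lt_le_trans ax; rewrite ltrDl invr_gt0.
have sF n x : F n x -> a < x <= b.
  move=> Fx; suff : [set` `]a, b]] x by rewrite /= in_itv.
  by rewrite FE; exists n.
have ndF : nondecreasing_seq F.
  move=> n m nm; rewrite subsetEset => x; rewrite /F /= !in_itv /= => /andP[h ->].
  rewrite andbT; apply: le_trans h; rewrite lerD2l lef_pV2 ?posrE ?ltr0Sn //.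
  by rewrite ler_nat ltnS.
have mF n : measurable (F n) by exact: measurable_itv.
have cgF n : {within F n, continuous g}.
  by apply: continuous_in_subspaceT => x /set_mem /sF; exact: cg.
have mgF n : measurable_fun (F n) (EFin \o g).
  apply/measurable_EFinP; exact: subspace_continuous_measurable_fun.
have g0F n x : F n x -> (0 <= (EFin \o g) x)%E.
  by move=> /sF h; rewrite lee_fin g0.
rewrite FE.
have cvgI : (\int[mu]_(x in F n) (g x)%:E @[n --> \oo] -->
    \int[mu]_(x in \bigcup_n F n) (g x)%:E)%E.
  exact: ge0_nondecreasing_set_cvg_integral.
rewrite -(cvg_lim _ cvgI)//; apply: lime_le.
  by apply/cvg_ex; eexists; exact: cvgI.
apply: nearW => n /=; have [cb|bc|cb] := ltgtP (a + n.+1%:R^-1) b; last 2 first.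
- by rewrite /F set_itv_ge ?integral_set0 ?bnd_simp -?ltNge ?lee_fin ?G0 ?ab ?lexx.
- by rewrite /F cb set_itv1 integral_set1 lee_fin G0 ?ab ?lexx.
have dGF x : a + n.+1%:R^-1 <= x <= b -> is_derive x 1 G (g x).
  by move=> xab; apply: dG; apply: (@sF n); rewrite /F /= in_itv.
have -> := @continuous_FTC2 R g G _ _ cb (cgF n).
- by rewrite -EFinB lee_fin gerBl G0 // ltrDl invr_gt0 ltr0Sn ltW.
- have cG : {within F n, continuous G}.
    apply: derivable_within_continuous => x; rewrite in_itv /= => xab.
    by have [] := dGF x xab.
  have [_ Gl Gr] := (continuous_within_itvP _ cb).1 cG.
  split => // x; rewrite in_itv /= => /andP[cx xb].
  by have [] := dGF x _; rewrite ?ltW.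
- move=> x; rewrite in_itv /= => /andP[cx xb].
  by rewrite derive1E; apply/derive_val; apply: dGF; rewrite !ltW.
Qed.

Lemma is_derive_powR_comp (f : R -> R) (s x df : R) : 0 < f x ->
  is_derive x 1 f df ->
  is_derive x 1 (fun y => f y `^ s) (s * f x `^ (s - 1) * df).
Proof.
move=> fx0 dfx; have dp := is_derive1_powR s fx0.
exact: (@is_derive1_comp _ (fun y => y `^ s) f x).
Qed.

Lemma integral_powR_le (a b s : R) : a < b -> 0 < s ->
  (\int[mu]_(x in `]a, b]) ((x - a) `^ (s - 1))%:E <= (s^-1 * (b - a) `^ s)%:E)%E.
Proof.
move=> ab s0.
have dq (t x : R) : a < x ->
    is_derive x 1 (fun y => (y - a) `^ t) (t * (x - a) `^ (t - 1)).
  move=> ax; have dx : is_derive x 1 (fun y : R => y - a) 1.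
    by apply: is_derive_eq; rewrite subr0.
  have := @is_derive_powR_comp (fun y => y - a) t x 1 _ dx.
  by rewrite mulr1; apply; rewrite subr_gt0.
apply: (@ge0_integral_obnd_le (fun x => (x - a) `^ (s - 1))
  (fun x => s^-1 * (x - a) `^ s)) => // x /andP[ax _].
- have /= d := is_deriveZ (s^-1) (dq s x ax).
  by apply: (is_derive_eq d); rewrite /= /GRing.scale /= mulrA mulVf ?mul1r// gt_eqF.
- by rewrite powR_ge0.
- by rewrite mulr_ge0 ?powR_ge0// invr_ge0 ltW.
- have [d _] := dq (s - 1) x ax.
  exact/differentiable_continuous/derivable1_diffP.
Qed.

Lemma integrable_powR (a b s : R) : a < b -> 0 < s ->
  mu.-integrable `]a, b] (fun x => ((x - a) `^ (s - 1))%:E).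
Proof.
move=> ab s0; apply/integrableP; split.
  apply/measurable_EFinP.
  apply: (@measurableT_comp _ _ _ _ _ _ (fun x : R => x `^ (s - 1))).
    exact: measurable_powR.
  exact: measurable_funB.
under eq_integral do rewrite /= ger0_norm ?powR_ge0//.
by apply: le_lt_trans (integral_powR_le ab s0) _; rewrite ltry.
Qed.

(** Rescaling q = x - a by l shows that l^(s - 2) is the right order.  To get the constant
    without splitting the integral at q = l, the integrand is compared with the
    derivative of (2 / s) l^(s - 2) (q / (l + q))^s, using (l + q)^2 <= 2 (l^2 + q^2) and
    l^(1 - s) <= (l + q)^(1 - s). *)
Lemma integral_powR_div_le (a b s l : R) : a < b -> 0 < s <= 1 -> 0 < l ->
  (\int[mu]_(x in `]a, b]) ((x - a) `^ (s - 1) / (l ^+ 2 + (x - a) ^+ 2))%:E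
    <= (2 * s^-1 * l `^ (s - 2))%:E)%E.
Proof.
move=> ab /andP[s0 s1] l0.
pose r x := (x - a) / (l + (x - a)).
have q0 x : a < x -> 0 < x - a by rewrite subr_gt0.
have lq0 x : a < x -> 0 < l + (x - a) by move=> ax; rewrite addr_gt0 ?q0.
have r0 x : a < x -> 0 < r x by move=> ax; rewrite divr_gt0 ?q0 ?lq0.
have r1 x : a < x -> r x <= 1.
  by move=> ax; rewrite ler_pdivrMr ?lq0// mul1r lerDr ltW.
have dq (x : R) : is_derive x 1 (fun y : R => y - a) 1.
  by apply: is_derive_eq; rewrite subr0.
have dr x : a < x -> is_derive x 1 r (l / (l + (x - a)) ^+ 2).
  move=> ax.
  have dlq : is_derive x 1 (fun y : R => l + (y - a)) 1.
    by apply: is_derive_eq; rewrite add0r mulr1.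
  have dV : is_derive x 1 (fun y : R => (l + (y - a))^-1) (- (l + (x - a)) ^- 2).
    apply: DeriveDef; first by apply: derivableV; [exact: lt0r_neq0 (lq0 _ ax)|case: dlq].
    by rewrite deriveV ?(lt0r_neq0 (lq0 _ ax))// derive_val /GRing.scale /= mulr1.
  have d := is_deriveM (dq x) dV.
  apply: (is_derive_eq d); rewrite /GRing.scale /=.
  field; exact: lt0r_neq0 (lq0 _ ax).
(* Up to a constant, the integrand is below the derivative of r^s. *)
pose C := 2 * s^-1 * l `^ (s - 2).
have C0 : 0 <= C by rewrite /C !mulr_ge0 ?powR_ge0// invr_ge0 ltW.
pose G x := C * r x `^ s.
pose g x := C * (s * r x `^ (s - 1) * (l / (l + (x - a)) ^+ 2)).
have dG x : a < x -> is_derive x 1 G (g x).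
  move=> ax; exact: (is_deriveZ C (@is_derive_powR_comp r s x _ (r0 _ ax) (dr _ ax))).
have cg x : a < x -> {for x, continuous g}.
  move=> ax; have [dr' _] := dr x ax.
  have [d' _] := @is_derive_powR_comp r (s - 1) x _ (r0 _ ax) (dr _ ax).
  have cr := (differentiable_continuous ((derivable1_diffP _ _).1 d')).
  rewrite /prop_for /continuous_at /g; apply: cvgM; first exact: cvg_cst.
  apply: cvgM; first by apply: cvgM; [exact: cvg_cst|exact: cr].
  apply: cvgM; first exact: cvg_cst.
  apply: cvgV; first by rewrite expf_neq0// lt0r_neq0// lq0.
  apply: (@cvg_comp _ _ _ (fun y => l + (y - a)) (fun z => z ^+ 2));
    last exact: exprn_continuous.
  apply: cvgD; first exact: cvg_cst.
  by apply: cvgB; [exact: cvg_id|exact: cvg_cst].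
have g0 x : a < x -> 0 <= g x.
  by move=> ax; rewrite !mulr_ge0 ?powR_ge0 ?invr_ge0 ?sqr_ge0 ?(ltW s0) ?(ltW l0).
apply: (@le_trans _ _ (\int[mu]_(x in `]a, b]) (g x)%:E)%E); last first.
  apply: le_trans (@ge0_integral_obnd_le g G a b ab _ _ _ _) _.
  - by move=> x /andP[/dG].
  - by move=> x /andP[/g0].
  - by move=> x _; rewrite mulr_ge0// powR_ge0.
  - by move=> x /andP[/cg].
  rewrite lee_fin /G ler_piMr//.
  by rewrite -(powRr0 (r b)) ger_powR ?r0 ?r1// ltW.
apply: ge0_le_integral => //=.
- move=> x /=; rewrite in_itv /= => /andP[ax _]; rewrite lee_fin divr_ge0 ?powR_ge0//.
  by rewrite addr_ge0 ?sqr_ge0.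
- apply/measurable_EFinP; apply: measurable_fun_obnd_continuous => x ax.
  have [d' _] := @is_derive_powR_comp _ (s - 1) x _ (q0 _ ax) (dq x).
  rewrite /prop_for /continuous_at; apply: cvgM.
    exact: (differentiable_continuous ((derivable1_diffP _ _).1 d')).
  apply: cvgV; first by rewrite lt0r_neq0// ltr_wpDr ?sqr_ge0// exprn_gt0.
  apply: cvgD; first exact: cvg_cst.
  apply: (@cvg_comp _ _ _ (fun y => y - a) (fun z => z ^+ 2));
    last exact: exprn_continuous.
  by apply: cvgB; [exact: cvg_id|exact: cvg_cst].
- apply/measurable_EFinP; apply: measurable_fun_obnd_continuous; exact: cg.
- move=> x /=; rewrite in_itv /= => /andP[ax _]; rewrite lee_fin.
  rewrite /g /C.
  have [q0' lq0'] := (q0 _ ax, lq0 _ ax).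
  have rE : r x `^ (s - 1) = (x - a) `^ (s - 1) * (l + (x - a)) `^ (1 - s).
    rewrite /r powRM ?invr_ge0 ?(ltW q0') ?(ltW lq0')//; congr (_ * _).
    by rewrite -powR_inv1 ?(ltW lq0')// -powRrM mulN1r opprB.
  have lE : l `^ (s - 2) * l `^ (1 - s) = l^-1.
    rewrite -powRD ?(lt0r_neq0 l0) ?implybT// -powR_inv1 ?ltW//.
    by congr (_ `^ _); ring.
  have lle : l `^ (1 - s) <= (l + (x - a)) `^ (1 - s).
    by rewrite ge0_ler_powR ?subr_ge0 ?nnegrE ?(ltW l0) ?(ltW lq0')// lerDl ltW.
  have -> : 2 / s * l `^ (s - 2) * (s * r x `^ (s - 1) * (l / (l + (x - a)) ^+ 2)) =
      2 * (l `^ (s - 2) * (l + (x - a)) `^ (1 - s) * l) * (x - a) `^ (s - 1) /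
        (l + (x - a)) ^+ 2.
    by rewrite rE; field; rewrite !lt0r_neq0.
  apply: (@le_trans _ _ (2 * (x - a) `^ (s - 1) / (l + (x - a)) ^+ 2)); last first.
    rewrite ler_wpM2r ?invr_ge0 ?sqr_ge0// ler_wpM2r ?powR_ge0// ler_pMr//.
    rewrite -ler_pdivrMr// div1r -lE ler_wpM2l ?powR_ge0//.
  rewrite mulrC mulrAC ler_wpM2r ?powR_ge0// -[leLHS]div1r ler_pdivrMr; last first.
    by rewrite ltr_wpDr ?sqr_ge0// exprn_gt0.
  rewrite mulrAC ler_pdivlMr ?exprn_gt0// mul1r -subr_ge0.
  have -> : 2 * (l ^+ 2 + (x - a) ^+ 2) - (l + (x - a)) ^+ 2 = (l - (x - a)) ^+ 2 by ring.
  exact: sqr_ge0.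
Qed.

End half_open_integrals.

(** * Laplace transforms of t sin (s t) and t cos (s t) *)

Section kernels.
Variable R : realType.
Implicit Types l t : R.

(** The Laplace transforms at l of t sin (s t) and t cos (s t), as functions of s: the
    imaginary and real parts of (l - i s)^-2. *)
Definition sin_kernel (l t : R) := 2 * l * t / (l ^+ 2 + t ^+ 2) ^+ 2.
Definition cos_kernel (l t : R) := (l ^+ 2 - t ^+ 2) / (l ^+ 2 + t ^+ 2) ^+ 2.

Let den_gt0 l t : 0 < l -> 0 < l ^+ 2 + t ^+ 2.
Proof. by move=> l0; rewrite ltr_wpDr ?sqr_ge0// exprn_gt0. Qed.

Let normr_div_le l t x : 0 < l -> `|x| <= l ^+ 2 + t ^+ 2 ->
  `|x / (l ^+ 2 + t ^+ 2) ^+ 2| <= (l ^+ 2 + t ^+ 2)^-1.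
Proof.
move=> l0; have := den_gt0 t l0; set D := l ^+ 2 + t ^+ 2 => D0 xD.
rewrite normrM [X in _ * X]gtr0_norm ?invr_gt0 ?exprn_gt0//.
by rewrite ler_pdivrMr ?exprn_gt0// expr2 mulrA mulVf ?mul1r// lt0r_neq0.
Qed.

Lemma normr_sin_kernel_le l t : 0 < l ->
  `|sin_kernel l t| <= (l ^+ 2 + t ^+ 2)^-1.
Proof.
move=> l0; apply: normr_div_le => //; rewrite ler_norml; apply/andP; split.
  by rewrite -subr_ge0 (_ : _ - _ = (l + t) ^+ 2) ?sqr_ge0//; ring.
by rewrite -subr_ge0 (_ : _ - _ = (l - t) ^+ 2) ?sqr_ge0//; ring.
Qed.

Lemma normr_cos_kernel_le l t : 0 < l ->
  `|cos_kernel l t| <= (l ^+ 2 + t ^+ 2)^-1.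
Proof.
move=> l0; apply: normr_div_le => //.
by rewrite ler_norml; have := sqr_ge0 l; have := sqr_ge0 t; lra.
Qed.

Lemma inv_sqrD_le l t : 0 < l -> (l ^+ 2 + t ^+ 2)^-1 <= l ^- 2.
Proof.
move=> l0; have D0 := den_gt0 t l0.
by rewrite lef_pV2 ?posrE ?exprn_gt0// lerDl sqr_ge0.
Qed.

Lemma le_sin_kernel (l q t c C : R) : 0 < l -> 0 < c -> 0 < q ->
  c * q <= t <= C * q ->
  2 * (c * l * q / (l ^+ 2 + (C * q) ^+ 2) ^+ 2) <= sin_kernel l t.
Proof.
move=> l0 c0 q0 /andP[ct tC].
have cq0 : 0 < c * q by rewrite mulr_gt0.
have t0 : 0 < t := lt_le_trans cq0 ct.
have C0 : 0 < C by rewrite -(pmulr_lgt0 _ q0); exact: lt_le_trans tC.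
have D1 : 0 < l ^+ 2 + t ^+ 2 by rewrite addr_gt0 ?exprn_gt0.
have D2 : 0 < l ^+ 2 + (C * q) ^+ 2 by rewrite addr_gt0 ?exprn_gt0 ?mulr_gt0.
rewrite /sin_kernel -!mulrA ler_pM2l//; rewrite mulrCA ler_pM2l// mulrA.
apply: ler_pM => //; first exact: ltW.
  by rewrite invr_ge0 sqr_ge0.
rewrite lef_pV2 ?posrE ?exprn_gt0// ler_sqr ?nnegrE ?(ltW D1) ?(ltW D2)//.
by rewrite lerD2l ler_sqr ?nnegrE ?(ltW t0)// ltW// (lt_le_trans t0).
Qed.

Let cvg_den l t : 0 < l ->
  ((l ^+ 2 + x ^+ 2) ^+ 2)^-1 @[x --> t] --> ((l ^+ 2 + t ^+ 2) ^+ 2)^-1.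
Proof.
move=> l0; apply: cvgV; first by rewrite expf_neq0// lt0r_neq0// den_gt0.
apply: (@cvg_comp _ _ _ (fun x => l ^+ 2 + x ^+ 2) (fun z => z ^+ 2));
  last exact: exprn_continuous.
by apply: cvgD; [exact: cvg_cst|exact: exprn_continuous].
Qed.

Lemma measurable_sin_kernel l : 0 < l -> measurable_fun setT (sin_kernel l).
Proof.
move=> l0; apply: continuous_measurable_fun => s; apply: cvgM; last exact: cvg_den.
by apply: cvgM; [exact: cvg_cst|exact: cvg_id].
Qed.

Lemma measurable_cos_kernel l : 0 < l -> measurable_fun setT (cos_kernel l).
Proof.
move=> l0; apply: continuous_measurable_fun => s; apply: cvgM; last exact: cvg_den.
by apply: cvgB; [exact: cvg_cst|exact: exprn_continuous].
Qed.

End kernels.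

Section laplace.
Variable R : realType.
Local Notation mu := (@lebesgue_measure R).
Implicit Types l s t : R.

(** A family that is closed under differentiation in t and contains the antiderivatives of
    e^(- l t), t e^(- l t), t e^(- l t) sin (s t) and t e^(- l t) cos (s t). *)
Definition exp_trig l s (a b c d e f : R) (t : R) : R :=
  expR (- (l * t)) *
    ((a + b * t) + (c + d * t) * cos (s * t) + (e + f * t) * sin (s * t)).

Lemma is_derive_exp_trig l s a b c d e f t :
  is_derive t 1 (exp_trig l s a b c d e f)
    (exp_trig l s (b - l * a) (- l * b)
       (d - l * c + s * e) (- l * d + s * f)
       (f - l * e - s * c) (- l * f - s * d) t).
Proof.
have dlin (k : R) : is_derive t 1 (fun u : R => k * u) k.
  have dk := is_deriveZ k (is_derive_id t 1).
  by apply: (is_derive_eq dk); rewrite /GRing.scale /= mulr1.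
have dE : is_derive t 1 (fun u : R => expR (- (l * u))) (expR (- (l * t)) * - l).
  apply: (is_derive1_comp (f := expR) (g := fun u => - (l * u))).
have dC : is_derive t 1 (fun u : R => cos (s * u)) (- sin (s * t) * s).
  exact: (is_derive1_comp (f := cos) (g := fun u => s * u)).
have dS : is_derive t 1 (fun u : R => sin (s * u)) (cos (s * t) * s).
  exact: (is_derive1_comp (f := sin) (g := fun u => s * u)).
have daff (k m : R) : is_derive t 1 (fun u : R => k + m * u) m.
  have dk := is_deriveD (is_derive_cst k t 1) (dlin m).
  by apply: (is_derive_eq dk); rewrite add0r.
have d1 := is_deriveM dE (is_deriveD
  (is_deriveD (daff a b) (is_deriveM (daff c d) dC)) (is_deriveM (daff e f) dS)).
apply: (is_derive_eq d1); rewrite /exp_trig /GRing.scale /= !fctE; ring.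
Qed.

Lemma exp_trig_cvg0 l s a b c d e f : 0 < l ->
  exp_trig l s a b c d e f t @[t --> +oo] --> 0.
Proof.
move=> l0.
(* The factor 1 + 2 / l is such that 1 + t <= (1 + 2 / l) e^(l t / 2): half of the
   exponential absorbs the affine factors. *)
pose K := (`|a| + `|b| + (`|c| + `|d|) + (`|e| + `|f|)) * (1 + 2 / l).
have bound t : 0 <= t -> `|exp_trig l s a b c d e f t| <= K * expR (- (l / 2 * t)).
  move=> t0; rewrite /exp_trig normrM (gtr0_norm (expR_gt0 _)).
  have -> : expR (- (l * t)) = expR (- (l / 2 * t)) * expR (- (l / 2 * t)).
    by rewrite -expRD; congr expR; field.
  rewrite -[leLHS]mulrA [leRHS]mulrC ler_wpM2l ?expR_ge0//.
  have aff (x y : R) : `|x + y * t| <= (`|x| + `|y|) * (1 + t).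
    apply: le_trans (ler_normD _ _) _; rewrite normrM (ger0_norm t0).
    have := normr_ge0 x; have := normr_ge0 y; nra.
  have trig (x y z : R) : `|z| <= 1 -> `|(x + y * t) * z| <= (`|x| + `|y|) * (1 + t).
    by move=> z1; rewrite normrM; apply: le_trans (aff x y); rewrite ler_piMr.
  set X := (X in `|X|); set y := expR _.
  have y1 : (1 + t) * y <= 1 + 2 / l.
    rewrite /y expRN ler_pdivrMr ?expR_gt0//.
    apply: (@le_trans _ _ ((1 + 2 / l) * (1 + l / 2 * t))); last first.
      by rewrite ler_wpM2l ?expR_ge1Dx// addr_ge0 ?divr_ge0 ?(ltW l0).
    have -> : (1 + 2 / l) * (1 + l / 2 * t) = 1 + t + (2 / l + l / 2 * t).
      by field; exact: lt0r_neq0.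
    by rewrite lerDl addr_ge0 ?mulr_ge0 ?invr_ge0 ?(ltW l0).
  have XS : `|X| <= (`|a| + `|b| + (`|c| + `|d|) + (`|e| + `|f|)) * (1 + t).
    rewrite 2!mulrDl; apply: le_trans (ler_normD _ _) _; apply: lerD; last first.
      by apply: trig; rewrite ler_norml sin_geN1 sin_le1.
    apply: le_trans (ler_normD _ _) _; apply: lerD; first exact: aff.
    by apply: trig; rewrite ler_norml cos_geN1 cos_le1.
  rewrite mulrC /K; apply: le_trans (ler_wpM2r (expR_ge0 _) XS) _.
  by rewrite -[leLHS]mulrA ler_wpM2l// !addr_ge0.
have cvgE : K * expR (- (l / 2 * t)) @[t --> +oo] --> 0.
  rewrite -[X in _ --> X](mulr0 K); apply: cvgM; first exact: cvg_cst.
  apply: (@cvg_comp _ _ _ (fun t => l / 2 * t) (fun x => expR (- x)));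
    last exact: cvgr_expR.
  by apply: gt0_cvgMry; [rewrite divr_gt0|exact: cvg_id].
apply/norm_cvg0P; apply: (squeeze_cvgr _ (cvg_cst 0) cvgE).
near=> t; rewrite normr_ge0 bound//; near: t; exact: nbhs_pinfty_ge.
Unshelve. all: by end_near. Qed.

(** The integrand is the derivative of exp_trig l s a b c d e f, which tends to 0 at
    infinity and equals a + c at 0. *)
Lemma laplace_exp_trig l s a b c d e f : 0 < l ->
  (forall t, 0 <= t -> 0 <= exp_trig l s
       (b - l * a) (- l * b) (d - l * c + s * e) (- l * d + s * f)
       (f - l * e - s * c) (- l * f - s * d) t) ->
  (\int[mu]_(t in `[0%R, +oo[) (exp_trig l s
       (b - l * a) (- l * b) (d - l * c + s * e) (- l * d + s * f)
       (f - l * e - s * c) (- l * f - s * d) t)%:E = (- (a + c))%:E)%E.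
Proof.
move=> l0 ge0.
have d1 := is_derive_exp_trig l s a b c d e f.
have cont A B C D E F : continuous (exp_trig l s A B C D E F).
  move=> x; apply/differentiable_continuous/derivable1_diffP.
  by have [] := is_derive_exp_trig l s A B C D E F x.
rewrite (@ge0_continuous_FTC2y R _ (exp_trig l s a b c d e f) 0 0) //.
- rewrite sub0e -EFinN /exp_trig !mulr0 oppr0 expR0 cos0 sin0.
  by rewrite !mulr0 !addr0 mul1r mulr1.
- by apply: continuous_subspaceT; exact: cont.
- exact: exp_trig_cvg0.
- by apply: cvg_at_right_filter; exact: cont.
- by move=> x _; rewrite derive1E; apply: derive_val.
Qed.

Lemma laplace_ge0 (g : R -> R) (v l s a b c d e f : R) : 0 < l ->
  (forall t, g t = exp_trig l s
       (b - l * a) (- l * b) (d - l * c + s * e) (- l * d + s * f)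
       (f - l * e - s * c) (- l * f - s * d) t) ->
  (forall t, 0 <= t -> 0 <= g t) -> v = - (a + c) ->
  mu.-integrable `[0%R, +oo[ (EFin \o g) /\ \int[mu]_(t in `[0, +oo[) g t = v.
Proof.
move=> l0 gE g0 ->.
have I : (\int[mu]_(t in `[0%R, +oo[) (g t)%:E = (- (a + c))%:E)%E.
  under eq_integral do rewrite gE.
  by apply: laplace_exp_trig => // t t0; rewrite -gE g0.
split; last by rewrite /Rintegral I.
apply/integrableP; split.
  apply/measurable_EFinP; apply: subspace_continuous_measurable_fun => //.
  apply: continuous_subspaceT => x; apply/differentiable_continuous/derivable1_diffP.
  have -> := funext gE.
  by have [] := is_derive_exp_trig l s (b - l * a) (- l * b)
    (d - l * c + s * e) (- l * d + s * f) (f - l * e - s * c) (- l * f - s * d) x.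
rewrite (_ : \int[mu]_(x in _) _ = (- (a + c))%:E)%E ?ltry// -I.
apply: eq_integral => t; rewrite inE /= in_itv /= andbT => t0.
by rewrite ger0_norm// g0.
Qed.

Lemma laplace_cst l : 0 < l ->
  mu.-integrable `[0%R, +oo[ (fun t => (expR (- (l * t)))%:E) /\
  \int[mu]_(t in `[0, +oo[) expR (- (l * t)) = l^-1.
Proof.
move=> l0; apply: (@laplace_ge0 _ _ l 0 (- l^-1) 0 0 0 0 0) => //.
- by move=> t; rewrite /exp_trig; field; exact: lt0r_neq0.
- by rewrite addr0 opprK.
Qed.

Lemma laplace_id l : 0 < l ->
  mu.-integrable `[0%R, +oo[ (fun t => (t * expR (- (l * t)))%:E) /\
  \int[mu]_(t in `[0, +oo[) (t * expR (- (l * t))) = l ^- 2.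
Proof.
move=> l0; apply: (@laplace_ge0 _ _ l 0 (- l ^- 2) (- l^-1) 0 0 0 0) => //.
- by move=> t; rewrite /exp_trig; field; exact: lt0r_neq0.
- by move=> t t0; rewrite mulr_ge0// expR_ge0.
- by rewrite addr0 opprK.
Qed.

(** Adding t e^(- l t) makes the integrand nonnegative, as the fundamental theorem of
    calculus on a half-line requires; its integral is subtracted at the end. *)
Lemma laplace_sin l s : 0 < l ->
  \int[mu]_(t in `[0, +oo[) (t * expR (- (l * t)) * sin (s * t)) =
    sin_kernel l s.
Proof.
move=> l0; pose D := l ^+ 2 + s ^+ 2.
have D0 : D != 0 by rewrite lt0r_neq0// ltr_wpDr ?sqr_ge0// exprn_gt0.
have [i0 I0] := laplace_id l0.
have [i1 I1] : mu.-integrable `[0%R, +oo[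
      (fun t => (t * expR (- (l * t)) * (1 + sin (s * t)))%:E) /\
    \int[mu]_(t in `[0, +oo[) (t * expR (- (l * t)) * (1 + sin (s * t))) =
      l ^- 2 + 2 * l * s / D ^+ 2.
  apply: (@laplace_ge0 _ _ l s (- l ^- 2) (- l^-1) (- (2 * l * s / D ^+ 2))
    (- s / D) (- ((l ^+ 2 - s ^+ 2) / D ^+ 2)) (- l / D)) => //.
  - by move=> t; rewrite /exp_trig /D; field; rewrite D0 lt0r_neq0.
  - move=> t t0; apply: mulr_ge0; first by rewrite mulr_ge0// expR_ge0.
    by have := sin_geN1 (s * t); lra.
  - by rewrite opprD !opprK.
transitivity (\int[mu]_(t in `[0, +oo[)
    (t * expR (- (l * t)) * (1 + sin (s * t)) - t * expR (- (l * t)))).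
  by apply: eq_Rintegral => t _; ring.
by rewrite RintegralB// I1 I0 addrAC subrr add0r.
Qed.

Lemma laplace_cos l s : 0 < l ->
  \int[mu]_(t in `[0, +oo[) (t * expR (- (l * t)) * cos (s * t)) =
    cos_kernel l s.
Proof.
move=> l0; pose D := l ^+ 2 + s ^+ 2.
have D0 : D != 0 by rewrite lt0r_neq0// ltr_wpDr ?sqr_ge0// exprn_gt0.
have [i0 I0] := laplace_id l0.
have [i1 I1] : mu.-integrable `[0%R, +oo[
      (fun t => (t * expR (- (l * t)) * (1 + cos (s * t)))%:E) /\
    \int[mu]_(t in `[0, +oo[) (t * expR (- (l * t)) * (1 + cos (s * t))) =
      l ^- 2 + (l ^+ 2 - s ^+ 2) / D ^+ 2.
  apply: (@laplace_ge0 _ _ l s (- l ^- 2) (- l^-1) (- ((l ^+ 2 - s ^+ 2) / D ^+ 2))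
    (- l / D) (2 * l * s / D ^+ 2) (s / D)) => //.
  - by move=> t; rewrite /exp_trig /D; field; rewrite D0 lt0r_neq0.
  - move=> t t0; apply: mulr_ge0; first by rewrite mulr_ge0// expR_ge0.
    by have := cos_geN1 (s * t); lra.
  - by rewrite opprD !opprK.
transitivity (\int[mu]_(t in `[0, +oo[)
    (t * expR (- (l * t)) * (1 + cos (s * t)) - t * expR (- (l * t)))).
  by apply: eq_Rintegral => t _; ring.
by rewrite RintegralB// I1 I0 addrAC subrr add0r.
Qed.

End laplace.

(** * Averaging an oscillatory integral in the frequency *)

Section fubini_bounded.
Context d1 d2 (T1 : measurableType d1) (T2 : measurableType d2) (R : realType).
Variable m1 : {sigma_finite_measure set T1 -> \bar R}.
Variable m2 : {sigma_finite_measure set T2 -> \bar R}.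
Variables (k : T1 -> R) (g : T2 -> R) (h : T1 * T2 -> R).
Hypothesis ik : m1.-integrable setT (EFin \o k).
Hypothesis ig : m2.-integrable setT (EFin \o g).
Hypothesis mh : measurable_fun setT h.
Hypothesis h1 : forall z, `|h z| <= 1.

Let F z := (k z.1 * (g z.2 * h z))%:E.

Let mF : measurable_fun setT F.
Proof.
have /integrableP[/measurable_EFinP mk _] := ik.
have /integrableP[/measurable_EFinP mg _] := ig.
apply/measurable_EFinP/measurable_funM; first exact: measurableT_comp mk measurable_fst.
by apply: measurable_funM => //; exact: measurableT_comp mg measurable_snd.
Qed.

Let iF : (m1 \x m2)%E.-integrable setT F.
Proof.
have /integrableP[mk ik'] := ik.
have /integrableP[mg ig'] := ig.
have mk' : measurable_fun setT (fun x => `|(k x)%:E|%E) by exact: measurableT_comp.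
have mg' : measurable_fun setT (fun y => `|(g y)%:E|%E) by exact: measurableT_comp.
apply/integrable12ltyP => //.
apply: (@le_lt_trans _ _
  (\int[m1]_x (`|(k x)%:E| * \int[m2]_y `|(g y)%:E|))%E); last first.
  rewrite ge0_integralZr//; last exact: integral_ge0.
  by rewrite lte_mul_pinfty// ?integral_ge0// ge0_fin_numE ?integral_ge0.
apply: ge0_le_integral => //.
- by move=> x _; exact: integral_ge0.
- apply: (measurable_fun_fubini_tonelli_F (abse \o F)).
    exact: measurableT_comp.
  by move=> z /=; rewrite lee_fin.
- by apply: emeasurable_funM => //; exact: measurable_cst.
- move=> x _; rewrite -ge0_integralZl//.
  apply: ge0_le_integral => //.
  + apply: measurableT_comp => //; apply: measurableT_comp mF _.
    exact: pair1_measurable.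
  + by apply: emeasurable_funM => //; exact: measurable_cst.
  + move=> y _; rewrite -abseM /F /= lee_fin !normrM ler_wpM2l//.
    by rewrite ler_piMr.
Qed.

Let i2 x : m2.-integrable setT (fun y => (g y * h (x, y))%:E).
Proof.
apply: (le_integrable _ _ _ ig) => //.
- have /integrableP[/measurable_EFinP mg _] := ig.
  apply/measurable_EFinP/measurable_funM => //.
  by apply: measurableT_comp mh _; exact: pair1_measurable.
- by move=> y _; rewrite lee_fin normrM ler_piMr.
Qed.

Let i1 y : m1.-integrable setT (fun x => (k x * h (x, y))%:E).
Proof.
apply: (le_integrable _ _ _ ik) => //.
- have /integrableP[/measurable_EFinP mk _] := ik.
  apply/measurable_EFinP/measurable_funM => //.
  by apply: measurableT_comp mh _; exact: pair2_measurable.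
- by move=> x _; rewrite lee_fin normrM ler_piMr.
Qed.

Let FE x : (\int[m2]_y F (x, y) = (k x * \int[m2]_y (g y * h (x, y)))%:E)%E.
Proof.
rewrite EFinM /Rintegral fineK; last exact: integrable_fin_num.
by rewrite -integralZl.
Qed.

Let GE y : (\int[m1]_x F (x, y) = (g y * \int[m1]_x (k x * h (x, y)))%:E)%E.
Proof.
rewrite EFinM /Rintegral fineK; last exact: integrable_fin_num.
rewrite -integralZl//; apply: eq_integral => x _; congr EFin; rewrite /F /=; ring.
Qed.

Lemma integrable_fubini_bounded :
  m1.-integrable setT (fun x => (k x * \int[m2]_y (g y * h (x, y)))%:E).
Proof.
rewrite (_ : (fun x => _) = fubini_F m2 F); first exact: integrable_fubini_F.
by apply/funext => x; rewrite /fubini_F FE.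
Qed.

Lemma Rintegral_fubini_bounded :
  \int[m1]_x (k x * \int[m2]_y (g y * h (x, y))) =
  \int[m2]_y (g y * \int[m1]_x (k x * h (x, y))).
Proof.
rewrite /Rintegral; congr fine.
transitivity (\int[m1]_x \int[m2]_y F (x, y))%E.
  by apply: eq_integral => x _; rewrite FE.
by rewrite Fubini//; apply: eq_integral => y _; rewrite GE.
Qed.

End fubini_bounded.

Section averaging.
Variable R : realType.
Local Notation mu := (@lebesgue_measure R).

(** The phase is extended by 0 outside D, where the integrand vanishes anyway. *)
Lemma Rintegral_fubini_oscillatory (E D : set R) (k f th T : R -> R) :
  measurable E -> measurable D ->
  mu.-integrable E (EFin \o k) -> mu.-integrable D (EFin \o f) ->
  measurable_fun D th -> measurable_fun setT T -> (forall x, `|T x| <= 1) ->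
  mu.-integrable E (fun w => (k w * \int[mu]_(p in D) (f p * T (th p * w)))%:E) /\
  \int[mu]_(w in E) (k w * \int[mu]_(p in D) (f p * T (th p * w))) =
  \int[mu]_(p in D) (f p * \int[mu]_(w in E) (k w * T (th p * w))).
Proof.
move=> mE mD ik jf mth mT T1.
pose h (z : R * R) := T ((th \_ D) z.2 * z.1).
have ik' : mu.-integrable setT (EFin \o (k \_ E)).
  by rewrite -restrict_EFin; apply: (iffLR (integrable_mkcond _ _) ik).
have jf' : mu.-integrable setT (EFin \o (f \_ D)).
  by rewrite -restrict_EFin; apply: (iffLR (integrable_mkcond _ _) jf).
have mth' : measurable_fun setT (th \_ D) by apply/(measurable_restrictT _ mD).
have mh : measurable_fun setT h.
  apply: measurableT_comp mT _; apply: measurable_funM => //.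
  exact: measurableT_comp mth' measurable_snd.
have h1 z : `|h z| <= 1 by exact: T1.
have patchM (A : set R) (u v : R -> R) :
    (fun x => u x * v x) \_ A = (fun x => (u \_ A) x * v x).
  by apply/funext => x; rewrite !patchE; case: ifP => // _; rewrite mul0r.
have IE w : \int[mu]_y ((f \_ D) y * h (w, y)) =
    \int[mu]_(p in D) (f p * T (th p * w)).
  rewrite [RHS]Rintegral_mkcond; apply: eq_Rintegral => y _; rewrite /h /= !patchE.
  by case: ifP => // _; rewrite mul0r.
have JE p : D p -> \int[mu]_x ((k \_ E) x * h (x, p)) =
    \int[mu]_(w in E) (k w * T (th p * w)).
  move=> Dp; rewrite [RHS]Rintegral_mkcond; apply: eq_Rintegral => y _.
  rewrite /h /= !patchE.
  by rewrite (mem_set Dp); case: ifP => // _; rewrite mul0r.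
split.
  have := integrable_fubini_bounded ik' jf' mh h1.
  under eq_fun do rewrite IE.
  move=> H; apply: (iffRL (integrable_mkcond _ _)) => //.
  rewrite (_ : (_ \_ E) = EFin \o (fun w =>
    (k \_ E) w * \int[mu]_(p in D) (f p * T (th p * w))))//.
  by rewrite -patchM -restrict_EFin.
transitivity (\int[mu]_x ((k \_ E) x * \int[mu]_y ((f \_ D) y * h (x, y)))).
  rewrite Rintegral_mkcond patchM; apply: eq_Rintegral => x _.
  by rewrite IE.
rewrite (Rintegral_fubini_bounded ik' jf' mh h1) [RHS]Rintegral_mkcond patchM.
apply: eq_Rintegral => p _; rewrite !patchE.
by case: ifPn => [/set_mem/JE->//|_]; rewrite !mul0r.
Qed.

Lemma laplace_oscillatory (D : set R) (f g th : R -> R) (l : R) : 0 < l ->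
  measurable D -> mu.-integrable D (EFin \o f) -> mu.-integrable D (EFin \o g) ->
  measurable_fun D th ->
  let Y w := \int[mu]_(p in D) (f p * sin (th p * w) + g p * cos (th p * w)) in
  mu.-integrable `[0%R, +oo[ (fun w => (w * expR (- (l * w)) * Y w)%:E) /\
  \int[mu]_(w in `[0, +oo[) (w * expR (- (l * w)) * Y w) =
  \int[mu]_(p in D) (f p * sin_kernel l (th p) + g p * cos_kernel l (th p)).
Proof.
move=> l0 mD jf jg mth Y.
have mE : measurable (`[0%R, +oo[%classic : set R) by exact: measurable_itv.
have [ik _] := laplace_id l0.
have sin1 (x : R) : `|sin x| <= 1 by rewrite ler_norml sin_geN1 sin_le1.
have cos1 (x : R) : `|cos x| <= 1 by rewrite ler_norml cos_geN1 cos_le1.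
have msin : measurable_fun setT (@sin R).
  by apply: continuous_measurable_fun; exact: continuous_sin.
have mcos : measurable_fun setT (@cos R).
  by apply: continuous_measurable_fun; exact: continuous_cos.
have [i1 I1] := Rintegral_fubini_oscillatory mE mD ik jf mth msin sin1.
have [i2 I2] := Rintegral_fubini_oscillatory mE mD ik jg mth mcos cos1.
have mD' : measurable (D : set (measurableTypeR R)) := mD.
have mthw w : measurable_fun D (fun p => th p * w) by exact: measurable_funM.
have js w : mu.-integrable D (EFin \o (fun p => f p * sin (th p * w))).
  exact: (integrable_mul_bounded mD jf (measurableT_comp msin (mthw w)) (fun p _ => sin1 _)).
have jc w : mu.-integrable D (EFin \o (fun p => g p * cos (th p * w))).
  exact: (integrable_mul_bounded mD jg (measurableT_comp mcos (mthw w)) (fun p _ => cos1 _)).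
have YE w : w * expR (- (l * w)) * Y w =
    w * expR (- (l * w)) * \int[mu]_(p in D) (f p * sin (th p * w)) +
    w * expR (- (l * w)) * \int[mu]_(p in D) (g p * cos (th p * w)).
  by rewrite /Y (RintegralD mD' (js w) (jc w)) mulrDr.
split.
  rewrite (_ : (fun w => _) = (fun w =>
      (w * expR (- (l * w)) * \int[mu]_(p in D) (f p * sin (th p * w)))%:E +
      (w * expR (- (l * w)) * \int[mu]_(p in D) (g p * cos (th p * w)))%:E)%E).
    exact: integrableD.
  by apply/funext => w; rewrite YE EFinD.
transitivity (\int[mu]_(w in `[0, +oo[)
    (w * expR (- (l * w)) * \int[mu]_(p in D) (f p * sin (th p * w)) +
     w * expR (- (l * w)) * \int[mu]_(p in D) (g p * cos (th p * w)))).
  by apply: eq_Rintegral => w _; exact: YE.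
rewrite RintegralD// I1 I2.
have jS : mu.-integrable D (EFin \o (fun p => f p * sin_kernel l (th p))).
  apply: (integrable_mul_bounded mD jf (measurableT_comp (measurable_sin_kernel l0) mth)).
  by move=> p _; apply: le_trans (normr_sin_kernel_le _ l0) (inv_sqrD_le _ l0).
have jC : mu.-integrable D (EFin \o (fun p => g p * cos_kernel l (th p))).
  apply: (integrable_mul_bounded mD jg (measurableT_comp (measurable_cos_kernel l0) mth)).
  by move=> p _; apply: le_trans (normr_cos_kernel_le _ l0) (inv_sqrD_le _ l0).
rewrite (RintegralD mD' jS jC).
by congr (_ + _); apply: eq_Rintegral => p _; rewrite ?laplace_sin ?laplace_cos.
Qed.

End averaging.

(** * Upper and lower bounds for the average *)

Section averaged_bounds.
Variable R : realType.
Local Notation mu := (@lebesgue_measure R).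

Lemma powR_le_1D (x t : R) : 0 <= x -> 0 <= t <= 1 -> x `^ t <= 1 + x.
Proof.
move=> x0 /andP[t0 t1]; have [x1|x1] := leP x 1.
  apply: (@le_trans _ _ 1); last by rewrite lerDl.
  by have := @ge0_ler_powR _ t t0 x 1; rewrite !nnegrE powR1; apply.
apply: (@le_trans _ _ x); last by rewrite lerDr.
by rewrite -[leRHS](powRr1 x0) ler_powR// ltW.
Qed.

(** A decay w^-s of Y, up to e, becomes a growth l^(s - 2) of its transform.  Beyond M,
    w |Y w| <= e w^(1 - s) <= e l^(s - 1) (1 + l w); and [0, M] contributes an amount
    that does not depend on l because e^(- l w) <= 1 <= e^(M - w) there. *)
Lemma laplace_decay_le (Y : R -> R) (s e A M l : R) : 0 < s <= 1 -> 0 < l ->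
  0 <= e -> 0 <= A -> 0 <= M ->
  mu.-integrable `[0%R, +oo[ (fun w => (w * expR (- (l * w)) * Y w)%:E) ->
  (forall w, `|Y w| <= A) -> (forall w, M < w -> w `^ s * `|Y w| <= e) ->
  `|\int[mu]_(w in `[0, +oo[) (w * expR (- (l * w)) * Y w)| <=
    A * M * expR M + 2 * e * l `^ (s - 2).
Proof.
move=> /andP[s0 s1] l0 e0 A0 M0 iY YA Ye.
pose P := A * M * expR M; pose Q := e * l `^ (s - 1).
have P0 : 0 <= P by rewrite !mulr_ge0 ?expR_ge0.
have Q0 : 0 <= Q by rewrite mulr_ge0 ?powR_ge0.
have [j1 J1] := laplace_cst (@ltr01 R).
have [j2 J2] := laplace_cst l0.
have [j3 J3] := laplace_id l0.
(* b1 dominates the integrand on [0, M], and b2 + b3 dominates it beyond M. *)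
pose b1 w : R := P * expR (- (1 * w)).
pose b2 w : R := Q * expR (- (l * w)).
pose b3 w : R := (Q * l) * (w * expR (- (l * w))).
have i1 : mu.-integrable `[0%R, +oo[ (EFin \o b1).
  exact: (integrableZl _ P j1).
have i2 : mu.-integrable `[0%R, +oo[ (EFin \o b2).
  exact: (integrableZl _ Q j2).
have i3 : mu.-integrable `[0%R, +oo[ (EFin \o b3).
  exact: (integrableZl _ (Q * l) j3).
have i23 : mu.-integrable `[0%R, +oo[ (EFin \o (b2 \+ b3)).
  exact: (integrableD _ i2 i3).
have i123 : mu.-integrable `[0%R, +oo[ (EFin \o (fun w => b1 w + (b2 w + b3 w))).
  exact: (integrableD _ i1 i23).
have -> : A * M * expR M + 2 * e * l `^ (s - 2) =
    \int[mu]_(w in `[0, +oo[) (b1 w + (b2 w + b3 w)).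
  rewrite RintegralD// RintegralD// !RintegralZl// J1 J2 J3 invr1 mulr1.
  have -> : l `^ (s - 2) = l `^ (s - 1) / l.
    rewrite (_ : s - 2 = (s - 1) - 1); last by ring.
    by rewrite powRB ?(lt0r_neq0 l0) ?implybT// powRr1// ltW.
  rewrite /P /Q; field; exact: lt0r_neq0.
apply: le_trans (le_normr_Rintegral _ _) _ => //.
apply: le_Rintegral => //; first exact: integrable_norm iY.
move=> w /=; rewrite in_itv /= andbT => w0.
rewrite !normrM (ger0_norm w0) (gtr0_norm (expR_gt0 _)).
have [wM|Mw] := leP w M.
  apply: (@le_trans _ _ (b1 w)); last first.
    rewrite lerDl /b2 /b3; apply: addr_ge0; first by rewrite mulr_ge0 ?expR_ge0.
    by apply: mulr_ge0; apply: mulr_ge0; rewrite ?expR_ge0 ?(ltW l0).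
  rewrite /b1 /P -[leRHS]mulrA -expRD.
  apply: (@le_trans _ _ (M * 1 * A)).
    apply: ler_pM => //; first by rewrite mulr_ge0 ?expR_ge0.
    apply: ler_pM => //.
    by rewrite -expR0 ler_expR oppr_le0 mulr_ge0// ltW.
  rewrite mulr1 [leLHS]mulrC ler_peMr ?mulr_ge0// -[leLHS]expR0 ler_expR; lra.
apply: (@le_trans _ _ (b2 w + b3 w)); last by rewrite lerDr /b1 mulr_ge0 ?expR_ge0.
have -> : b2 w + b3 w = Q * (1 + l * w) * expR (- (l * w)) by rewrite /b2 /b3; ring.
rewrite mulrAC ler_wpM2r ?expR_ge0//.
have wp : 0 < w := le_lt_trans M0 Mw.
have wE : w = w `^ (1 - s) * w `^ s.
  by rewrite -powRD ?(lt0r_neq0 wp) ?implybT// subrK powRr1.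
rewrite [X in X * _ <= _]wE -[leLHS]mulrA; apply: (@le_trans _ _ (w `^ (1 - s) * e)).
  by rewrite ler_wpM2l ?powR_ge0// Ye.
rewrite mulrC /Q -mulrA ler_wpM2l//.
(* w^(1 - s) is rescaled by l, so that (l w)^(1 - s) <= 1 + l w applies. *)
have -> : w `^ (1 - s) = l `^ (s - 1) * (l * w) `^ (1 - s).
  rewrite powRM ?(ltW l0)// mulrA -powRD ?(lt0r_neq0 l0) ?implybT//.
  by rewrite addrA subrK subrr powRr0 mul1r.
rewrite ler_wpM2l ?powR_ge0// powR_le_1D ?mulr_ge0 ?(ltW l0)//.
by rewrite subr_ge0 s1 gerBl ltW.
Qed.

(** The kernels have size (l^2 + t^2)^-1 at most.  Within distance d of the end point the
    bounds on u and v apply, and t is comparable to q; further away the kernels are at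
    most (c d)^-2, so everything is absorbed in a constant independent of l. *)
Lemma averaged_amplitude_ge (l q t c C u v K a0 e d : R) :
  0 < l -> 0 < c <= 1 -> 0 < q -> c * q <= t <= C * q ->
  0 < d -> 0 <= a0 -> 0 <= e -> `|u| <= K -> `|v| <= K ->
  (q <= d -> a0 <= u /\ `|v| <= e) ->
  2 * a0 * (c * l * q / (l ^+ 2 + (C * q) ^+ 2) ^+ 2)
    - e / c ^+ 2 / (l ^+ 2 + q ^+ 2) - (2 * K + a0) / (c * d) ^+ 2
  <= u * sin_kernel l t + v * cos_kernel l t.
Proof.
move=> l0 /andP[c0 c1] q0 tb d0 a00 e0 uK vK near.
have K0 : 0 <= K := le_trans (normr_ge0 _) uK.
have /andP[ct tC] := tb.
have cq0 : 0 < c * q by rewrite mulr_gt0.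
have t0 : 0 < t := lt_le_trans cq0 ct.
have Dt : 0 < l ^+ 2 + t ^+ 2 by rewrite addr_gt0 ?exprn_gt0.
have Dq : 0 < l ^+ 2 + q ^+ 2 by rewrite addr_gt0 ?exprn_gt0.
have S1 := le_sin_kernel l0 c0 q0 tb.
have S2 : sin_kernel l t <= (l ^+ 2 + t ^+ 2)^-1.
  exact: le_trans (ler_norm _) (normr_sin_kernel_le t l0).
have S3 := normr_cos_kernel_le t l0.
set S := c * l * q / _ in S1 *.
have S0 : 0 <= S by rewrite /S divr_ge0 ?sqr_ge0// !mulr_ge0 ?ltW.
have kd0 : 0 <= (2 * K + a0) / (c * d) ^+ 2.
  by rewrite divr_ge0 ?sqr_ge0// addr_ge0// mulr_ge0.
have ec0 : 0 <= e / c ^+ 2 / (l ^+ 2 + q ^+ 2).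
  by rewrite !divr_ge0 ?sqr_ge0// ltW.
have [qd|dq] := leP q d.
  have [au ve] := near qd.
  have vc : - (e / c ^+ 2 / (l ^+ 2 + q ^+ 2)) <= v * cos_kernel l t.
    rewrite lerNl; apply: le_trans (ler_norm _) _; rewrite normrN normrM.
    apply: (@le_trans _ _ (e * (l ^+ 2 + t ^+ 2)^-1)); first exact: ler_pM.
    rewrite -mulrA ler_wpM2l// -invfM lef_pV2 ?posrE ?mulr_gt0 ?exprn_gt0//.
    rewrite mulrDr -!exprMn; apply: lerD;
      last by rewrite ler_sqr ?nnegrE ?(ltW cq0) ?(ltW t0).
    by rewrite ler_sqr ?nnegrE ?(ltW (mulr_gt0 c0 l0)) ?(ltW l0)// ler_piMl// ltW.
  have uS : 2 * a0 * S <= u * sin_kernel l t.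
    rewrite [2 * a0]mulrC -mulrA; apply: ler_pM => //.
    by rewrite mulr_ge0.
  lra.
have Td : (l ^+ 2 + t ^+ 2)^-1 <= ((c * d) ^+ 2)^-1.
  rewrite lef_pV2 ?posrE ?exprn_gt0 ?mulr_gt0//.
  apply: (@le_trans _ _ (t ^+ 2)); last by rewrite lerDr sqr_ge0.
  rewrite ler_sqr ?nnegrE ?(ltW t0) ?mulr_ge0 ?ltW//.
  by apply: lt_le_trans ct; rewrite ltr_pM2l.
have P0 : 0 <= ((c * d) ^+ 2)^-1 by rewrite invr_ge0 sqr_ge0.
have SS0 : 0 <= sin_kernel l t by apply: le_trans S1; rewrite mulr_ge0.
have b1 : - (K * ((c * d) ^+ 2)^-1) <= u * sin_kernel l t.
  rewrite lerNl; apply: le_trans (ler_norm _) _; rewrite normrN normrM ler_pM//.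
  by rewrite ger0_norm// (le_trans S2).
have b2 : - (K * ((c * d) ^+ 2)^-1) <= v * cos_kernel l t.
  rewrite lerNl; apply: le_trans (ler_norm _) _; rewrite normrN normrM ler_pM//.
  exact: le_trans S3 Td.
have b3 : 2 * a0 * S <= a0 * ((c * d) ^+ 2)^-1.
  rewrite [2 * a0]mulrC -mulrA ler_wpM2l//; apply: le_trans S1 _.
  exact: le_trans S2 Td.
have -> : (2 * K + a0) / (c * d) ^+ 2 =
  2 * (K * ((c * d) ^+ 2)^-1) + a0 * ((c * d) ^+ 2)^-1 by ring.
lra.
Qed.

(** The three terms of averaged_amplitude_ge, integrated against q^(s - 1): the first two
    scale like l^(s - 2), and the first dominates once e is small compared with a0. *)
Lemma averaged_integral_ge (a b s c C K a0 e d l : R) (u v th : R -> R) :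
  a < b -> 0 < s <= 1 -> 0 < c <= 1 -> 0 < d -> 0 <= a0 -> 0 <= e ->
  0 < l -> a + 2 * l <= b ->
  measurable_fun `]a, b] u -> measurable_fun `]a, b] v -> measurable_fun `]a, b] th ->
  (forall p, a < p <= b -> `|u p| <= K /\ `|v p| <= K) ->
  (forall p, a < p <= b -> p - a <= d -> a0 <= u p /\ `|v p| <= e) ->
  (forall p, a < p <= b -> c * (p - a) <= th p <= C * (p - a)) ->
  (2 * a0 * c / (1 + (2 * C) ^+ 2) ^+ 2 - 2 / s * (e / c ^+ 2)) * l `^ (s - 2)
    - (2 * K + a0) / (c * d) ^+ 2 * (s^-1 * (b - a) `^ s)
  <= \int[mu]_(p in `]a, b]) ((p - a) `^ (s - 1) * u p * sin_kernel l (th p) +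
        (p - a) `^ (s - 1) * v p * cos_kernel l (th p)).
Proof.
move=> ab /andP[s0 s1] c01 d0 a00 e0 l0 lb mfu mfv mth uvK near thc.
have c0 : 0 < c by case/andP: c01.
have W := integrable_powR ab s0.
pose w p := (p - a) `^ (s - 1).
have w0 p : 0 <= w p by exact: powR_ge0.
have mD : measurable (`]a, b]%classic : set R) by exact: measurable_itv.
have Dq p : a < p <= b -> 0 < p - a by case/andP => ap _; rewrite subr_gt0.
pose S p := c * l * (p - a) / (l ^+ 2 + (C * (p - a)) ^+ 2) ^+ 2.
pose V p := (l ^+ 2 + (p - a) ^+ 2)^-1.
have C0 : 0 < C.
  have bb : a < b <= b by rewrite ab lexx.
  have /andP[h1 h2] := thc b bb; rewrite -(pmulr_lgt0 _ (Dq b bb)).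
  by apply: lt_le_trans (le_trans h1 h2); rewrite mulr_gt0 ?Dq.
have jS : mu.-integrable `]a, b] (fun p => (w p * S p)%:E).
  (* S is a multiple of the sine kernel for the linear phase C (p - a). *)
  rewrite (_ : (fun p => _) = (fun p =>
      (c / (2 * C))%:E * (w p * sin_kernel l (C * (p - a)))%:E)%E); last first.
    apply/funext => p; rewrite -EFinM; congr EFin; rewrite /S /sin_kernel.
    have : 0 < l ^+ 2 + (C * (p - a)) ^+ 2 by rewrite ltr_wpDr ?sqr_ge0// exprn_gt0.
    by move: (w p) => ? ?; field; rewrite !lt0r_neq0.
  apply: integrableZl => //.
  apply: (@integrable_mul_bounded _ _ _ _ (l ^- 2)) => //.
    apply: measurableT_comp (measurable_sin_kernel l0) _.
    by apply: measurable_funM => //; exact: measurable_funB.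
  by move=> p _; exact: le_trans (normr_sin_kernel_le _ l0) (inv_sqrD_le _ l0).
have jV : mu.-integrable `]a, b] (fun p => (w p * V p)%:E).
  apply: (@integrable_mul_bounded _ _ _ _ (l ^- 2)) => //.
    apply: measurable_fun_obnd_continuous => x _.
    apply: cvgV; first by rewrite lt0r_neq0// ltr_wpDr ?sqr_ge0// exprn_gt0.
    apply: cvgD; first exact: cvg_cst.
    apply: (@cvg_comp _ _ _ (fun y => y - a) (fun z => z ^+ 2));
      last exact: exprn_continuous.
    by apply: cvgB; [exact: cvg_id|exact: cvg_cst].
  by move=> p _; rewrite ger0_norm ?inv_sqrD_le// invr_ge0 addr_ge0 ?sqr_ge0.
have jwu (z : R -> R) (ker : R -> R -> R) : measurable_fun `]a, b] z ->
    (forall p, a < p <= b -> `|z p| <= K) -> measurable_fun setT (ker l) ->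
    (forall t, `|ker l t| <= (l ^+ 2 + t ^+ 2)^-1) ->
    mu.-integrable `]a, b] (fun p => (w p * z p * ker l (th p))%:E).
  move=> mz zK mker kerb.
  apply: (@integrable_mul_bounded _ _ _ _ (l ^- 2)) => //; last 2 first.
  - exact: measurableT_comp mker mth.
  - by move=> p _; exact: le_trans (kerb _) (inv_sqrD_le _ l0).
  by apply: (@integrable_mul_bounded _ _ _ _ K) => // p; rewrite /= in_itv; exact: zK.
have jf : mu.-integrable `]a, b] (fun p => (w p * u p * sin_kernel l (th p) +
        w p * v p * cos_kernel l (th p))%:E).
  have j1 := jwu u (@sin_kernel R) mfu (fun p Dp => (uvK p Dp).1)
    (measurable_sin_kernel l0) (fun t => normr_sin_kernel_le t l0).
  have j2 := jwu v (@cos_kernel R) mfv (fun p Dp => (uvK p Dp).2)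
    (measurable_cos_kernel l0) (fun t => normr_cos_kernel_le t l0).
  exact: (integrableD _ j1 j2).
pose k := (2 * K + a0) / (c * d) ^+ 2.
(* The main term is integrated over ]a + l, a + 2 l] only: by homogeneity this already
   gives the full order l^(s - 2). *)
have S_ge : c / (1 + (2 * C) ^+ 2) ^+ 2 * l `^ (s - 2) <=
    \int[mu]_(p in `]a, b]) (w p * S p).
  have -> : c / (1 + (2 * C) ^+ 2) ^+ 2 * l `^ (s - 2) =
      (l `^ s * (c * l / (l ^+ 2 + (2 * C * l) ^+ 2) ^+ 2)) * ((a + 2 * l) - (a + l)).
    have -> : l `^ (s - 2) = l `^ s / l ^+ 2.
      by rewrite powRB ?(lt0r_neq0 l0) ?implybT// powR_mulrn// ltW.
    field; rewrite !lt0r_neq0//.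
      by rewrite ltr_wpDr ?sqr_ge0.
    by rewrite ltr_wpDr ?sqr_ge0// exprn_gt0.
  apply: le_Rintegral_obnd_cst => //.
  - move=> p /Dq q0; rewrite mulr_ge0// divr_ge0 ?sqr_ge0//.
    by rewrite !mulr_ge0 ?ltW.
  - by rewrite lerDl ltW.
  - by rewrite lerD2l ler_peMl ?(ltW l0)// ler1n.
  - move=> p /andP[lp pl]; have lq : l < p - a by rewrite ltrBrDl.
    have q0 : 0 < p - a := lt_trans l0 lq.
    have q2l : p - a <= 2 * l by rewrite lerBlDl.
    have -> : w p * S p = (p - a) `^ s * (c * l / (l ^+ 2 + (C * (p - a)) ^+ 2) ^+ 2).
      rewrite -(mulr_powRB1 (ltW q0) s0) /w /S; ring.
    apply: ler_pM; [exact: powR_ge0| | |].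
    + by rewrite divr_ge0 ?sqr_ge0// mulr_ge0 ?ltW.
    + by rewrite ge0_ler_powR ?nnegrE ?(ltW l0) ?(ltW q0) ?(ltW s0) ?(ltW lq).
    + rewrite ler_wpM2l ?mulr_ge0 ?(ltW c0) ?(ltW l0)//.
      have X0 : 0 < l ^+ 2 + (C * (p - a)) ^+ 2.
        by rewrite ltr_wpDr ?sqr_ge0// exprn_gt0.
      have X1 : 0 < l ^+ 2 + (2 * C * l) ^+ 2.
        by rewrite ltr_wpDr ?sqr_ge0// exprn_gt0.
      rewrite lef_pV2 ?posrE ?exprn_gt0// ler_sqr ?nnegrE ?(ltW X0) ?(ltW X1)//.
      rewrite lerD2l ler_sqr ?nnegrE ?mulr_ge0 ?(ltW C0) ?(ltW q0) ?(ltW l0)//.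
      by rewrite mulrAC [2 * l * C]mulrC ler_wpM2l// ltW.
have V_le : \int[mu]_(p in `]a, b]) (w p * V p) <= 2 / s * l `^ (s - 2).
  by apply: le_Rintegral_EFin => //; apply: integral_powR_div_le; rewrite ?s0.
have W_le : \int[mu]_(p in `]a, b]) w p <= s^-1 * (b - a) `^ s.
  by apply: le_Rintegral_EFin => //; exact: integral_powR_le.
have k0 : 0 <= k.
  have bb : a < b <= b by rewrite ab lexx.
  have [uK _] := uvK b bb; have K0 := le_trans (normr_ge0 _) uK.
  by rewrite /k divr_ge0 ?sqr_ge0// addr_ge0// mulr_ge0.
have ec0 : 0 <= e / c ^+ 2 by rewrite divr_ge0 ?sqr_ge0.
have jZ m (g : R -> R) : mu.-integrable `]a, b] (EFin \o g) ->
    mu.-integrable `]a, b] (EFin \o (fun p => m * g p)).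
  by move=> jg; exact: (integrableZl _ m jg).
have jSV : mu.-integrable `]a, b]
    (EFin \o (fun p => 2 * a0 * (w p * S p) - e / c ^+ 2 * (w p * V p))).
  exact: (integrableB _ (jZ _ _ jS) (jZ _ _ jV)).
have jSVw : mu.-integrable `]a, b]
    (EFin \o (fun p => 2 * a0 * (w p * S p) - e / c ^+ 2 * (w p * V p) - k * w p)).
  exact: (integrableB _ jSV (jZ _ _ W)).
apply: (@le_trans _ _ (\int[mu]_(p in `]a, b])
    (2 * a0 * (w p * S p) - e / c ^+ 2 * (w p * V p) - k * w p))).
  rewrite RintegralB//=; last exact: (jZ _ _ W).
  rewrite RintegralB//=; [|exact: (jZ _ _ jS)|exact: (jZ _ _ jV)].
  rewrite !RintegralZl//.
  apply: lerB; last by rewrite ler_wpM2l.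
  rewrite mulrBl; apply: lerB.
    rewrite (_ : 2 * a0 * c / _ * _ =
        2 * a0 * (c / (1 + (2 * C) ^+ 2) ^+ 2 * l `^ (s - 2))).
      by rewrite ler_wpM2l// mulr_ge0.
    by rewrite !mulrA.
  by rewrite [2 / s * (e / _)]mulrC -[leRHS]mulrA ler_wpM2l.
apply: le_Rintegral => //.
move=> p /=; rewrite in_itv /= => Dp.
have [uK vK] := uvK p Dp.
have h := averaged_amplitude_ge l0 c01 (Dq p Dp) (thc p Dp) d0 a00 e0 uK vK (near p Dp).
have := ler_wpM2l (w0 p) h.
rewrite (_ : w p * (_ - _ - _) =
    2 * a0 * (w p * S p) - e / c ^+ 2 * (w p * V p) - k * w p); last first.
  rewrite /S /V /k; ring.
by rewrite mulrDr !mulrA.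
Qed.

(** If w^s times the integral were at most k / 8 for all large w, with k the constant of
    averaged_integral_ge for e = 0, then laplace_decay_le and averaged_integral_ge would
    bound k / 2 l^(s - 2) as l tends to 0. *)
Lemma oscillatory_decay_optimal (a b s c C K a0 : R) (u v th : R -> R) :
  a < b -> 0 < s <= 1 -> 0 < a0 -> 0 < c <= 1 ->
  measurable_fun `]a, b] u -> measurable_fun `]a, b] v -> measurable_fun `]a, b] th ->
  (forall p, a < p <= b -> `|u p| <= K /\ `|v p| <= K) ->
  (forall e, 0 < e -> exists2 d, 0 < d &
    forall p, a < p <= b -> p - a <= d -> a0 <= u p /\ `|v p| <= e) ->
  (forall p, a < p <= b -> c * (p - a) <= th p <= C * (p - a)) ->
  exists2 e, 0 < e & forall M, exists2 w, M < w &
    e <= w `^ s * `|\int[mu]_(p in `]a, b])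
      ((p - a) `^ (s - 1) * u p * sin (th p * w) +
       (p - a) `^ (s - 1) * v p * cos (th p * w))|.
Proof.
move=> ab s01 a00 c01 mfu mfv mth uvK near thc.
have [s0 s1] := andP s01; have [c0 c1] := andP c01.
pose Y w := \int[mu]_(p in `]a, b]) ((p - a) `^ (s - 1) * u p * sin (th p * w) +
       (p - a) `^ (s - 1) * v p * cos (th p * w)).
have [k kE] : exists k, k = 2 * a0 * c / (1 + (2 * C) ^+ 2) ^+ 2 by eexists.
have k0 : 0 < k.
  by rewrite kE divr_gt0 ?mulr_gt0 ?exprn_gt0// ltr_wpDr ?sqr_ge0.
have K0 : 0 <= K.
  have bb : a < b <= b by rewrite ab lexx.
  by have [uK _] := uvK b bb; exact: le_trans (normr_ge0 _) uK.
have k8 : 0 < k / 8 by rewrite divr_gt0.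
have k2 : 0 < k / 2 by rewrite divr_gt0.
exists (k / 8) => //.
move=> M1; apply: contrapT => noY.
pose M := Num.max M1 0.
have M0 : 0 <= M by rewrite le_max lexx orbT.
have Ye w : M < w -> w `^ s * `|Y w| <= k / 8.
  rewrite gt_max => /andP[M1w _]; rewrite leNgt; apply/negP => h.
  by apply: noY; exists w => //; exact: ltW.
have W := integrable_powR ab s0.
have mD : measurable (`]a, b]%classic : set R) by exact: measurable_itv.
have jwu (z : R -> R) : measurable_fun `]a, b] z ->
    (forall p, a < p <= b -> `|z p| <= K) ->
    mu.-integrable `]a, b] (EFin \o (fun p => (p - a) `^ (s - 1) * z p)).
  by move=> mz zK; apply: (@integrable_mul_bounded _ _ _ _ K).
have ju := jwu u mfu (fun p Dp => (uvK p Dp).1).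
have jv := jwu v mfv (fun p Dp => (uvK p Dp).2).
have sin1 (x : R) : `|sin x| <= 1 by rewrite ler_norml sin_geN1 sin_le1.
have cos1 (x : R) : `|cos x| <= 1 by rewrite ler_norml cos_geN1 cos_le1.
pose A := \int[mu]_(p in `]a, b]) ((p - a) `^ (s - 1) * (K + K)).
have jA : mu.-integrable `]a, b] (EFin \o (fun p => (p - a) `^ (s - 1) * (K + K))).
  apply: (@integrable_mul_bounded _ _ _ _ (K + K)) => //.
  by move=> p _; rewrite ger0_norm ?addr_ge0.
have A0 : 0 <= A.
  by apply: Rintegral_ge0 => p _; rewrite mulr_ge0 ?powR_ge0 ?addr_ge0.
have YA w : `|Y w| <= A.
  have mthw : measurable_fun `]a, b] (fun p => th p * w) by exact: measurable_funM.
  have jY : mu.-integrable `]a, b] (EFin \o (fun p =>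
      (p - a) `^ (s - 1) * u p * sin (th p * w) +
      (p - a) `^ (s - 1) * v p * cos (th p * w))).
    have j1 : mu.-integrable `]a, b]
        (fun p => ((p - a) `^ (s - 1) * u p * sin (th p * w))%:E).
      apply: (@integrable_mul_bounded _ _ _ _ 1) => //.
      apply: measurableT_comp mthw; apply: continuous_measurable_fun.
      exact: continuous_sin.
    have j2 : mu.-integrable `]a, b]
        (fun p => ((p - a) `^ (s - 1) * v p * cos (th p * w))%:E).
      apply: (@integrable_mul_bounded _ _ _ _ 1) => //.
      apply: measurableT_comp mthw; apply: continuous_measurable_fun.
      exact: continuous_cos.
    exact: (integrableD _ j1 j2).
  apply: le_trans (le_normr_Rintegral _ jY) _ => //.
  apply: le_Rintegral => //; first exact: integrable_norm jY.
  move=> p /=; rewrite in_itv /= => Dp; have [uK vK] := uvK p Dp.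
  apply: le_trans (ler_normD _ _) _; rewrite mulrDr.
  by apply: lerD; rewrite !normrM (ger0_norm (powR_ge0 _ _)) -[leLHS]mulrA
    ler_wpM2l ?powR_ge0// -[leRHS]mulr1 ler_pM.
(* With this bound on v near a, the cosine term costs k / 4 in front of l^(s - 2). *)
have e0 : 0 < k / 8 * c ^+ 2 * s by rewrite mulr_gt0// mulr_gt0// exprn_gt0.
have [d d0 nd] := near _ e0.
pose K1 := (2 * K + a0) / (c * d) ^+ 2 * (s^-1 * (b - a) `^ s).
pose K2 := A * M * expR M + K1.
have K20 : 0 <= K2.
  rewrite addr_ge0 ?mulr_ge0 ?expR_ge0 ?invr_ge0 ?sqr_ge0 ?powR_ge0 ?(ltW s0)//.
  by rewrite addr_ge0 ?mulr_ge0// ltW.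
(* Lower and upper bounds together: 3 k / 4 - 2 (k / 8) = k / 2. *)
have main l : 0 < l -> a + 2 * l <= b -> k / 2 * l `^ (s - 2) <= K2.
  move=> l0 lb.
  have [jL E] := laplace_oscillatory l0 mD ju jv mth.
  have up := laplace_decay_le s01 l0 (ltW k8) A0 M0 jL YA Ye.
  have lo := averaged_integral_ge ab s01 c01 d0 (ltW a00) (ltW e0) l0 lb
    mfu mfv mth uvK nd thc.
  rewrite E in up; move: (le_trans lo (le_trans (ler_norm _) up)).
  rewrite -kE -/K1 (_ : 2 / s * (k / 8 * c ^+ 2 * s / c ^+ 2) = k / 4); last first.
    by field; rewrite !lt0r_neq0.
  rewrite /K2; have := powR_ge0 l (s - 2); lra.
have K21 : 0 < K2 + 1 by rewrite ltr_wpDl.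
(* As l^(s - 2) >= l^-1 for l <= 1, the last constraint makes k / 2 l^(s - 2)
   exceed K2. *)
have [l [l0 l1 lb lk]] : exists l, [/\ 0 < l, l <= 1, a + 2 * l <= b &
    l <= k / (2 * (K2 + 1))].
  exists (Num.min (Num.min 1 ((b - a) / 2)) (k / (2 * (K2 + 1)))); split.
  - rewrite !lt_min ltr01 /=; apply/andP; split; first by rewrite divr_gt0 ?subr_gt0.
    by rewrite divr_gt0// mulr_gt0.
  - by rewrite !ge_min lexx.
  - rewrite addrC -lerBrDr mulrC -ler_pdivlMr//.
    by rewrite !ge_min lexx orbT.
  - by rewrite ge_min lexx orbT.
have : l^-1 <= l `^ (s - 2).
  rewrite -powR_inv1 ?(ltW l0)// ger_powR ?l0 ?l1//; lra.
move=> /(ler_wpM2l (ltW k2)) h.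
have := le_trans h (main l l0 lb); apply/negP; rewrite -ltNge.
rewrite ltr_pdivlMr//; move: lk; rewrite ler_pdivlMr ?mulr_gt0//.
nra.
Qed.

End averaged_bounds.

(** * Monotone phases *)

Section derivative_on_interval.
Variable R : realType.

Lemma derivable_within_cvg (V : normedModType R) (D : set R) (f : R -> V) (x : R) :
  derivable_within D f x -> f y @[y --> within D (nbhs x)] --> f x.
Proof.
move=> df; apply/cvgrPdist_le => e e0.
have c0 : (y - x) *: diff_quotient f x y @[y --> within D x^'] --> 0.
  have -> : (0 : V) = (x - x) *: lim (diff_quotient f x y @[y --> within D x^']).
    by rewrite subrr scale0r.
  apply: cvgZ df; apply: cvgB; last exact: cvg_cst.
  move=> P xP; change (nbhs x (fun y => y != x -> D y -> P y)).
  by apply: filterS xP => y Py _ _; exact: Py.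
have /cvgrPdist_le/(_ e e0) := c0.
move=> H; rewrite near_withinE.
have {}H : nbhs x (fun y => y != x -> D y ->
  `|0 - (y - x) *: diff_quotient f x y| <= e) by [].
apply: filterS H => y H Dy.
have [->|yx] := eqVneq y x; first by rewrite subrr normr0 ltW.
have := H yx Dy; rewrite /diff_quotient sub0r normrN scalerA divff ?subr_eq0//.
by rewrite scale1r distrC.
Qed.

Lemma derivable_within_continuous_on (V : normedModType R) (D : set R) (f : R -> V) :
  (forall x, D x -> derivable_within D f x) -> {within D, continuous f}.
Proof.
by move=> df; apply/subspace_continuousP => x /df/derivable_within_cvg.
Qed.

(** At an interior point the difference quotients relative to D are the ordinary ones. *)
Lemma is_derive_within (f : R -> R) (D : set R) (x : R) :
  derivable_within D f x -> nbhs x D -> is_derive x 1 f (derive_within D f x).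
Proof.
move=> df xD.
have E : (fun h => h^-1 *: (f (h *: (1 : R) + x) - f x)) =
    (diff_quotient f x) \o (fun h => h + x).
  by apply/funext => h; rewrite /= /diff_quotient addrK /GRing.scale /= mulr1.
have cx : (h + x) @[h --> 0^'] --> within D x^'.
  move=> P H; change (nbhs x (fun y => y != x -> D y -> P y)) in H.
  change (nbhs (0 : R) (fun h => h != 0 -> P (h + x))).
  have c : (h + x) @[h --> (0 : R)] --> 0 + x.
    by apply: cvgD; [exact: cvg_id|exact: cvg_cst].
  rewrite add0r in c.
  have cD : nbhs (0 : R) (fun h => D (h + x)) := c _ xD.
  have cP : nbhs (0 : R) (fun h => h + x != x -> D (h + x) -> P (h + x)) := c _ H.
  apply: filterS2 cD cP => h Dh Ph h0.
  by apply: Ph => //; rewrite -subr_eq0 addrK.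
have cf : h^-1 *: (f (h *: (1 : R) + x) - f x) @[h --> 0^'] --> derive_within D f x.
  by rewrite E; exact: cvg_comp cx df.
apply: DeriveDef; first by apply/cvg_ex; exists (derive_within D f x).
exact: cvg_lim cf.
Qed.

End derivative_on_interval.

Section monotone_phase.
Variable R : realType.

(** By monotonicity g lies between g a and g b, and by the intermediate value theorem
    these have the same sign, here sg. *)
Lemma monotone_nonvanishing_bounds (a b : R) (g : R -> R) : a < b ->
  {within `[a, b], continuous g} -> (forall p, a <= p <= b -> g p != 0) ->
  {in `[a, b] &, {homo g : x y / x <= y}} \/
  {in `[a, b] &, {homo g : x y /~ x <= y}} ->
  exists sg c C : R, [/\ sg = 1 \/ sg = -1, 0 < c <= 1 &
    forall p, a <= p <= b -> c <= sg * g p <= C].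
Proof.
move=> ab cg g0 mono.
have ain : a \in `[a, b] by rewrite in_itv /= lexx ltW.
have bin : b \in `[a, b] by rewrite in_itv /= lexx ltW.
have btw p : a <= p <= b -> Num.min (g a) (g b) <= g p <= Num.max (g a) (g b).
  move=> /andP[ap pb]; have pin : p \in `[a, b] by rewrite in_itv /= ap pb.
  case: mono => h.
    have h1 := h _ _ ain pin ap; have h2 := h _ _ pin bin pb.
    by rewrite ge_min le_max h1 h2 orbT.
  have h1 := h _ _ pin ain ap; have h2 := h _ _ bin pin pb.
  by rewrite ge_min le_max h1 h2 orbT.
have same : ~ (Num.min (g a) (g b) <= 0 <= Num.max (g a) (g b)).
  move=> h; have [x] := IVT (ltW ab) cg h.
  by rewrite in_itv /= => /g0 /eqP.
have [m0|m0] := ltP 0 (Num.min (g a) (g b)).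
  exists 1, (Num.min 1 (Num.min (g a) (g b))), (Num.max (g a) (g b)); split.
  - by left.
  - by rewrite lt_min ltr01 m0 ge_min lexx.
  - by move=> p /btw /andP[h1 h2]; rewrite mul1r h2 ge_min h1 orbT.
have M0 : Num.max (g a) (g b) < 0.
  by rewrite ltNge; apply/negP => M0; apply: same; rewrite m0 M0.
exists (-1), (Num.min 1 (- Num.max (g a) (g b))), (- Num.min (g a) (g b)); split.
- by right.
- by rewrite lt_min ltr01 oppr_gt0 M0 ge_min lexx.
- by move=> p /btw /andP[h1 h2]; rewrite mulN1r lerN2 h1 ge_min lerN2 h2 orbT.
Qed.

(** By the mean value theorem psi p - psi a is p - a times a value of the derivative. *)
Lemma phase_linear_bounds (a b : R) (psi : R -> R) : a < b ->
  class_C 2 `[a, b] psi ->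
  (forall p, a <= p <= b -> derive_within `[a, b] psi p != 0) ->
  {in `[a, b] &, {homo derive_within `[a, b] psi : x y / x <= y}} \/
  {in `[a, b] &, {homo derive_within `[a, b] psi : x y /~ x <= y}} ->
  exists sg c C : R, [/\ sg = 1 \/ sg = -1, 0 < c <= 1 &
    forall p, a < p <= b -> c * (p - a) <= sg * (psi p - psi a) <= C * (p - a)].
Proof.
move=> ab [dpsi [ddpsi _]] g0 mono.
have [sg [c [C [sgE c01 bnd]]]] := monotone_nonvanishing_bounds ab
  (derivable_within_continuous_on ddpsi) g0 mono.
exists sg, c, C; split => // p /andP[ap pb].
have cpsi : {within `[a, p], continuous psi}.
  apply: (@continuous_subspaceW _ _ _ `[a, b]);
    last exact: derivable_within_continuous_on.
  by move=> x /=; rewrite !in_itv /= => /andP[-> xp]; exact: le_trans pb.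
have dpsi' x : x \in `]a, p[ -> is_derive x 1 psi (derive_within `[a, b] psi x).
  rewrite in_itv /= => /andP[ax xp]; have xb := lt_le_trans xp pb.
  apply: is_derive_within.
    by apply: dpsi; rewrite /= in_itv /= !ltW.
  have xab : x \in `]a, b[ by rewrite in_itv /= ax.
  have := near_in_itvoo xab; apply: filterS => y /=.
  by rewrite !in_itv /= => /andP[ay yb]; rewrite !ltW.
have [x] := MVT ap dpsi' cpsi.
rewrite in_itv /= => /andP[ax xp] ->.
have /bnd /andP[h1 h2] : a <= x <= b by rewrite (ltW ax) (ltW (lt_le_trans xp pb)).
have pa : 0 <= p - a by rewrite subr_ge0 ltW.
by rewrite mulrA; apply/andP; split; exact: ler_wpM2r.
Qed.

End monotone_phase.

(** * Complex amplitudes *)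

Section complex_amplitude.
Variable R : realType.
Implicit Types z w : Rcomplex R.
Local Notation Re := (@complex.Re R).
Local Notation Im := (@complex.Im R).

Lemma Rcomplex_normE z : `|z| = Num.sqrt (Re z ^+ 2 + Im z ^+ 2).
Proof. by case: z. Qed.

Lemma normr_Re_le z : `|Re z| <= `|z|.
Proof.
by rewrite Rcomplex_normE -sqrtr_sqr ler_wsqrtr// lerDl sqr_ge0.
Qed.

Lemma normr_Im_le z : `|Im z| <= `|z|.
Proof.
by rewrite Rcomplex_normE -sqrtr_sqr ler_wsqrtr// lerDr sqr_ge0.
Qed.

Lemma Rcomplex_ReB z w : Re (z - w) = Re z - Re w. Proof. by case: z; case: w. Qed.

Lemma Rcomplex_ImB z w : Im (z - w) = Im z - Im w. Proof. by case: z; case: w. Qed.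

Lemma Rcomplex_ReM z w : Re (z * w) = Re z * Re w - Im z * Im w.
Proof. by case: z; case: w. Qed.

Lemma Rcomplex_ImM z w : Im (z * w) = Re z * Im w + Im z * Re w.
Proof. by case: z; case: w. Qed.

Lemma Rcomplex_ReZ (r : R) z : Re (r *: z) = r * Re z. Proof. by case: z. Qed.

Lemma Rcomplex_ImZ (r : R) z : Im (r *: z) = r * Im z. Proof. by case: z. Qed.

Lemma cvg_Re (T : Type) (F : set_system T) (FF : Filter F) (f : T -> Rcomplex R) z :
  f x @[x --> F] --> z -> Re (f x) @[x --> F] --> Re z.
Proof.
move=> /cvgrPdist_le fz; apply/cvgrPdist_le => e e0.
by apply: filterS (fz e e0) => x; apply: le_trans; rewrite -Rcomplex_ReB normr_Re_le.
Qed.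

Lemma cvg_Im (T : Type) (F : set_system T) (FF : Filter F) (f : T -> Rcomplex R) z :
  f x @[x --> F] --> z -> Im (f x) @[x --> F] --> Im z.
Proof.
move=> /cvgrPdist_le fz; apply/cvgrPdist_le => e e0.
by apply: filterS (fz e e0) => x; apply: le_trans; rewrite -Rcomplex_ImB normr_Im_le.
Qed.

(** Cauchy-Schwarz in the plane. *)
Lemma normr_dot_le (x y al be : R) z : al ^+ 2 + be ^+ 2 = x ^+ 2 + y ^+ 2 ->
  `|al * Im z + be * Re z| <= `|Rcomplex_of x y| * `|z|.
Proof.
move=> E; rewrite !Rcomplex_normE /= -sqrtrM ?addr_ge0 ?sqr_ge0// -sqrtr_sqr.
rewrite ler_wsqrtr// -E -subr_ge0.
rewrite (_ : _ - _ = (al * Re z - be * Im z) ^+ 2) ?sqr_ge0//; ring.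
Qed.

(** The left-hand side is sg times the imaginary part of (x0 - i y0) e^(- i phi) I.  The
    rotation by - phi turns the phase psi into psi - psi p1, and the parity of sine and
    cosine moves the sign sg into the phase and the cosine amplitude. *)
Lemma rotated_oscillatory_integral (p1 p2 s K : R) (U u : R -> Rcomplex R)
    (psi : R -> R) (x0 y0 sg w : R) : p1 < p2 -> 0 < s -> sg = 1 \/ sg = -1 ->
  (forall p, p1 < p <= p2 -> U p = (p - p1) `^ (s - 1) *: u p) ->
  {within `[p1, p2], continuous (fun p => Re (u p))} ->
  {within `[p1, p2], continuous (fun p => Im (u p))} ->
  {within `[p1, p2], continuous psi} ->
  (forall p, p1 < p <= p2 -> `|u p| <= K) ->
  let I := oscillatory_integral p1 p2 U psi w in
  let phi := w * psi p1 in
  sg * ((x0 * cos phi - y0 * sin phi) * Im I +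
        (- (x0 * sin phi + y0 * cos phi)) * Re I) =
  \int[lebesgue_measure]_(p in `]p1, p2])
    ((p - p1) `^ (s - 1) * (x0 * Re (u p) + y0 * Im (u p)) *
       sin (sg * (psi p - psi p1) * w) +
     (p - p1) `^ (s - 1) * (sg * (x0 * Im (u p) - y0 * Re (u p))) *
       cos (sg * (psi p - psi p1) * w)).
Proof.
move=> p12 s0 sgE UE cRe cIm cpsi uK I phi.
have mD : measurable (`]p1, p2]%classic : set R) by exact: measurable_itv.
have W := integrable_powR p12 s0.
have mtrig (T : R -> R) : continuous T ->
    measurable_fun `]p1, p2] (fun p => T (w * psi p)).
  move=> cT; apply: measurableT_comp; first exact: continuous_measurable_fun.
  by apply: measurable_funM => //; exact: within_continuous_measurable_oc.
have jw (v T : R -> R) : {within `[p1, p2], continuous v} ->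
    (forall p, p1 < p <= p2 -> `|v p| <= K) ->
    continuous T -> (forall x, `|T x| <= 1) ->
    lebesgue_measure.-integrable `]p1, p2]
      (EFin \o (fun p => (p - p1) `^ (s - 1) * v p * T (w * psi p))).
  move=> cv vK cT T1; apply: (@integrable_mul_bounded _ _ _ _ 1) => //;
    last exact: mtrig.
  apply: (@integrable_mul_bounded _ _ _ _ K) => //.
  exact: within_continuous_measurable_oc.
have sin1 (x : R) : `|sin x| <= 1 by rewrite ler_norml sin_geN1 sin_le1.
have cos1 (x : R) : `|cos x| <= 1 by rewrite ler_norml cos_geN1 cos_le1.
have ReK p (Dp : p1 < p <= p2) := le_trans (normr_Re_le (u p)) (uK p Dp).
have ImK p (Dp : p1 < p <= p2) := le_trans (normr_Im_le (u p)) (uK p Dp).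
have jRs := jw _ _ cRe ReK (@continuous_sin R) sin1.
have jRc := jw _ _ cRe ReK (@continuous_cos R) cos1.
have jIs := jw _ _ cIm ImK (@continuous_sin R) sin1.
have jIc := jw _ _ cIm ImK (@continuous_cos R) cos1.
(* fr and fi are the real and imaginary parts of the oscillating integrand. *)
pose fr p := (p - p1) `^ (s - 1) * Re (u p) * cos (w * psi p) -
  (p - p1) `^ (s - 1) * Im (u p) * sin (w * psi p).
pose fi p := (p - p1) `^ (s - 1) * Re (u p) * sin (w * psi p) +
  (p - p1) `^ (s - 1) * Im (u p) * cos (w * psi p).
have jfr : lebesgue_measure.-integrable `]p1, p2] (EFin \o fr).
  exact: (integrableB _ jRc jIs).
have jfi : lebesgue_measure.-integrable `]p1, p2] (EFin \o fi).
  exact: (integrableD _ jRs jIc).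
have -> : Re I = \int[lebesgue_measure]_(p in `]p1, p2]) fr p.
  apply: eq_Rintegral => p; rewrite inE /= in_itv /= => Dp.
  by rewrite UE// Rcomplex_ReM Rcomplex_ReZ Rcomplex_ImZ /fr.
have -> : Im I = \int[lebesgue_measure]_(p in `]p1, p2]) fi p.
  apply: eq_Rintegral => p; rewrite inE /= in_itv /= => Dp.
  by rewrite UE// Rcomplex_ImM Rcomplex_ReZ Rcomplex_ImZ /fi.
rewrite mulrDr !mulrA -!RintegralZl//.
have jZ m (g : R -> R) : lebesgue_measure.-integrable `]p1, p2] (EFin \o g) ->
    lebesgue_measure.-integrable `]p1, p2] (EFin \o (fun p => m * g p)).
  by move=> jg; exact: (integrableZl _ m jg).
rewrite -RintegralD//; [|exact: jZ|exact: jZ].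
apply: eq_Rintegral => p _.
have wE : (psi p - psi p1) * w = w * psi p - phi by rewrite mulrC mulrBr.
rewrite -[sg * _ * w]mulrA wE; case: sgE => ->;
  rewrite ?mul1r ?mulN1r ?sinN ?cosN sinB cosB /fr /fi; ring.
Qed.

End complex_amplitude.

(** * The decay rate is optimal *)

Lemma limf_esup_pinfty_gt0 (R : realType) (f : R -> R) (e : R) : 0 < e ->
  (forall M, exists2 w, M < w & e <= f w) ->
  (0 < limf_esup (fun w => (f w)%:E) (@pinfty_nbhs R))%E.
Proof.
move=> e0 fe; apply: (@lt_le_trans _ _ e%:E); first by rewrite lte_fin.
apply: le_ereal_inf_tmp => _ [V [M [_ MV]] <-].
have [w Mw ew] := fe M.
apply: (@le_trans _ _ (f w)%:E); first by rewrite lee_fin.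
by apply: ereal_sup_ubound; exists w => //; exact: MV.
Qed.

Theorem theorem3p14 (R : realType) (p1 p2 mu : R) (I : set R)
    (U u : R -> Rcomplex R) (psi : R -> R) :
  p1 < p2 ->
  open I -> is_interval I -> `[p1, p2] `<=` I ->
  0 < mu <= 1 ->
  regular_factor p1 p2 mu U u ->
  class_C 2 `[p1, p2] psi ->
  (forall p, p1 <= p <= p2 -> derive_within `[p1, p2] psi p != 0) ->
  {in `[p1, p2] &, {homo derive_within `[p1, p2] psi : x y / x <= y}} \/
  {in `[p1, p2] &, {homo derive_within `[p1, p2] psi : x y /~ x <= y}} ->
  class_C 1 `[p1, p2] u ->
  u p1 != 0 ->
  (0 < limf_esup (fun omega : R =>
         (omega `^ mu * `|oscillatory_integral p1 p2 U psi omega|)%:E)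
       (@pinfty_nbhs R))%E.
Proof.
move=> p12 _ _ _ mu01 [UE cu _ _ _] psiC psi'0 mono _ u0.
have [mu0 mu1] := andP mu01.
have [sg [c [C [sgE c01 thc]]]] := phase_linear_bounds p12 psiC psi'0 mono.
have cpsi : {within `[p1, p2], continuous psi}.
  by have [d _] := psiC; exact: derivable_within_continuous_on.
have cu' x : `[p1, p2]%classic x -> u y @[y --> within `[p1, p2] (nbhs x)] --> u x.
  by move=> Dx; move/subspace_continuousP : cu; apply.
have cRe : {within `[p1, p2], continuous (fun p => complex.Re (u p))}.
  by apply/subspace_continuousP => x /cu'; exact: cvg_Re.
have cIm : {within `[p1, p2], continuous (fun p => complex.Im (u p))}.
  by apply/subspace_continuousP => x /cu'; exact: cvg_Im.
have cnu : {within `[p1, p2], continuous (fun p => `|u p|)}.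
  by apply/subspace_continuousP => x /cu'; exact: cvg_norm.
have [pm _ um] := EVT_max (ltW p12) cnu.
pose K := `|u pm|.
have uK p : p1 < p <= p2 -> `|u p| <= K.
  by move=> /andP[a b]; apply: um; rewrite in_itv /= b ltW.
(* A + i B is u times the conjugate of u p1. *)
pose x0 := complex.Re (u p1); pose y0 := complex.Im (u p1).
pose A p := x0 * complex.Re (u p) + y0 * complex.Im (u p).
pose B p := x0 * complex.Im (u p) - y0 * complex.Re (u p).
have cA : {within `[p1, p2], continuous A}.
  by move=> x; apply: cvgD; (apply: cvgM; first exact: cvg_cst);
    [exact: cRe|exact: cIm].
have cB : {within `[p1, p2], continuous B}.
  by move=> x; apply: cvgB; (apply: cvgM; first exact: cvg_cst);
    [exact: cIm|exact: cRe].
have A0 : 0 < A p1.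
  have : 0 < `|u p1| by rewrite normr_gt0.
  by rewrite Rcomplex_normE sqrtr_gt0 /A -!expr2.
have B0 : B p1 = 0 by rewrite /B mulrC subrr.
have p1in : `[p1, p2]%classic p1 by rewrite /= in_itv /= lexx ltW.
pose K' := (`|x0| + `|y0|) * K.
have comb (m n : R) p : p1 < p <= p2 -> `|m| <= K -> `|n| <= K ->
    `|x0 * m + y0 * n| <= K'.
  move=> Dp mK nK; apply: le_trans (ler_normD _ _) _; rewrite /K' mulrDl.
  by apply: lerD; rewrite normrM ler_wpM2l.
pose th p := sg * (psi p - psi p1).
have sg2 : sg * sg = 1 by case: sgE => ->; ring.
have sgn : `|sg| = 1 by case: sgE => ->; rewrite ?normrN normr1.
have near e : 0 < e -> exists2 d, 0 < d &
    forall p, p1 < p <= p2 -> p - p1 <= d -> A p1 / 2 <= A p /\ `|sg * B p| <= e.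
  move=> e0.
  have cA1 : A y @[y --> within `[p1, p2] (nbhs p1)] --> A p1.
    by move/subspace_continuousP : cA; apply.
  have cB1 : B y @[y --> within `[p1, p2] (nbhs p1)] --> B p1.
    by move/subspace_continuousP : cB; apply.
  have A20 : 0 < A p1 / 2 by rewrite divr_gt0.
  have /cvgrPdist_le/(_ _ A20) := cA1; rewrite near_withinE => nA.
  have /cvgrPdist_le/(_ _ e0) := cB1; rewrite near_withinE => nB.
  have [d /= d0 nd] := (nbhs_ballP _ _).1 (filterI nA nB).
  exists (d / 2); first by rewrite divr_gt0.
  move=> p /andP[ap pb] pd.
  have Dp : `[p1, p2]%classic p by rewrite /= in_itv /= pb ltW.
  have bp : ball p1 d p.
    rewrite /ball /= distrC ger0_norm ?subr_ge0 ?(ltW ap)//.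
    by apply: le_lt_trans pd _; rewrite ltr_pdivrMr// ltr_pMr// ltr1n.
  have [/(_ Dp) hA /(_ Dp) hB] := nd p bp.
  split; last by rewrite normrM sgn mul1r; move: hB; rewrite B0 sub0r normrN.
  by move: hA; rewrite ler_norml => /andP[_]; lra.
have mB : measurable_fun `]p1, p2] (fun p => sg * B p).
  by apply: measurable_funM => //; exact: within_continuous_measurable_oc.
have mth : measurable_fun `]p1, p2] th.
  apply: measurable_funM => //; apply: measurable_funB => //.
  exact: within_continuous_measurable_oc.
have ABK p : p1 < p <= p2 -> `|A p| <= K' /\ `|sg * B p| <= K'.
  move=> Dp; have [rK iK] := (le_trans (normr_Re_le (u p)) (uK p Dp),
    le_trans (normr_Im_le (u p)) (uK p Dp)).
  split; first exact: comb Dp rK iK.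
  by rewrite normrM sgn mul1r /B -mulrN; apply: comb Dp iK _; rewrite normrN.
have A20 : 0 < A p1 / 2 by rewrite divr_gt0.
have [e e0 He] := oscillatory_decay_optimal p12 mu01 A20 c01
  (within_continuous_measurable_oc cA) mB mth ABK near thc.
have z0 : 0 < `|u p1| by rewrite normr_gt0.
apply: (@limf_esup_pinfty_gt0 _ _ (e / `|u p1|)); first by rewrite divr_gt0.
move=> M; have [w Mw] := He M; move=> ew; exists w => //.
rewrite ler_pdivrMr//; apply: le_trans ew _.
rewrite -mulrA ler_wpM2l ?powR_ge0//.
have := rotated_oscillatory_integral x0 y0 w p12 mu0 sgE UE cRe cIm cpsi uK.
rewrite -/(A _) -/(B _) => <-; rewrite normrM sgn mul1r [leRHS]mulrC.
have -> : `|u p1| = `|Rcomplex_of x0 y0| by rewrite /x0 /y0; case: (u p1).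
apply: normr_dot_le; have := cos2Dsin2 (w * psi p1).
move: (cos _) (sin _) => cs sn h.
rewrite -[RHS]mulr1 -h; ring.
Qed.
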